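(* There exists a bounded domain $\Omega\subset\mathbb{C}^4$ with smooth boundary such that: (1) $\partial\Omega$ does not satisfy weak $Z(2)$ under the Euclidean metric. (2) There exists a strictly plurisubharmonic exhaustion function $\varphi$ for $\mathbb{C}^4$ such that $\partial\Omega$ satisfies weak $Z(2)$ with respect to the metric $\omega=i\partial\bar\partial\varphi$.
   Context: Let $n=4$ and let $\rho$ be a smooth defining function of $\Omega$, i.e. $\Omega=\{\rho<0\}$ and $d\rho\ne0$ on $\partial\Omega$. For $z\in\partial\Omega$ let $T^{1,0}_z(\partial\Omega)=\{L\in T^{1,0}_z(\mathbb C^n):\partial\rho(L)=0\}$, and let $\mathcal L=\mathcal L_\rho$ be the Levi form, $\mathcal L(i\bar L\wedge L')=i\partial\bar\partial\rho(i\bar L\wedge L')$ for $L,L'\in T^{1,0}(\partial\Omega)$ (that is, $\mathcal L(i\bar L\wedge L')=\sum_{j,k}\frac{\partial^2\rho}{\partial z_j\partial\bar z_k}L'_j\bar L_k$). Weak $Z(q)$ with respect to the Kähler metric with Kähler form $\omega=i\partial\bar\partial\varphi$ (the Euclidean metric corresponds to $\varphi=|z|^2$): the eigenvalues $\mu_1\le\cdots\le\mu_{n-1}$ of $\mathcal L$ and the norm $|\theta|$ are taken with respect to this metric. A real $(1,1)$-vector $\Upsilon\in T^{1,1}(\partial\Omega)$ is written, in a local frame $L_1,\dots,L_{n-1}$ of $T^{1,0}(\partial\Omega)$, as $\Upsilon=i\sum_{j,k} b^{\bar kj}\bar L_k\wedge L_j$ with $(b^{\bar kj})$ hermitian (and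 here smooth), and a $(1,1)$-form $\eta=i\sum\eta_{j\bar k}\theta^j\wedge\bar\theta^k$ (dual coframe $\theta^j$) is paired with it by $\eta(\Upsilon)=\sum b^{\bar kj}\eta_{j\bar k}$. For $1\le q\le n-1$, $\partial\Omega$ satisfies weak $Z(q)$ if there is a real $\Upsilon\in T^{1,1}(\partial\Omega)$ such that: (i) $|\theta|^2\ge(i\theta\wedge\bar\theta)(\Upsilon)\ge0$ for all $(1,0)$-forms $\theta$ on $T^{1,0}(\partial\Omega)$; (ii) $\mu_1+\cdots+\mu_q-\mathcal L(\Upsilon)\ge0$ on $\partial\Omega$; (iii) $\omega(\Upsilon)\ne q$ at every point of $\partial\Omega$. *)

(* Defs.v *)
From HB Require Import structures.
From mathcomp Require Import all_boot all_order all_algebra.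
From mathcomp Require Import complex.
From mathcomp Require Import all_classical all_reals all_analysis.

Set Implicit Arguments.
Unset Strict Implicit.
Unset Printing Implicit Defensive.

Import Order.TTheory GRing.Theory Num.Theory.
Import numFieldNormedType.Exports.

Local Open Scope classical_set_scope.
Local Open Scope ring_scope.
Local Open Scope complex_scope.
Local Open Scope sesquilinear_scope.

(* C^n as the real normed space R^n x R^n: the pair (x, y) is x + iy. Points of
   C^n live here, so that the library's topology and directional derivatives
   are the real ones; complex tangent vectors and covectors are matrices over
   R[i]. *)
Definition Cspace (R : realType) (n : nat) := ('rV[R]_n * 'rV[R]_n)%type.

Section SmoothFunctions.
Context {R : realType} {n : nat}.
Implicit Types (V : set (Cspace R n)) (f : Cspace R n -> R).

(* meant for open V *)
Fixpoint Ck (k : nat) V f : Prop :=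
  {in V, continuous f} /\
  if k is k'.+1 then
    forall v : Cspace R n,
      {in V, forall z, derivable f z v} /\ Ck k' V (fun z => 'D_v f z)
  else True.

Definition smooth V f := forall k, Ck k V f.

Definition smooth_mx V p q (F : Cspace R n -> 'M[R[i]]_(p, q)) :=
  forall i j, smooth V (fun z => complex.Re (F z i j)) /\
              smooth V (fun z => complex.Im (F z i j)).

End SmoothFunctions.

Section ComplexDerivatives.
Context {R : realType} {n : nat}.
Implicit Types (f : Cspace R n -> R[i]) (rho : Cspace R n -> R).

Definition Dc (v : Cspace R n) f (z : Cspace R n) : R[i] :=
  'D_v (fun w => complex.Re (f w)) z +i* 'D_v (fun w => complex.Im (f w)) z.

Definition dx (j : 'I_n) : Cspace R n := (delta_mx 0 j, 0).
Definition dy (j : 'I_n) : Cspace R n := (0, delta_mx 0 j).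

Definition d_z (j : 'I_n) f (z : Cspace R n) : R[i] :=
  2^-1 * (Dc (dx j) f z - 'i%C * Dc (dy j) f z).
Definition d_zbar (j : 'I_n) f (z : Cspace R n) : R[i] :=
  2^-1 * (Dc (dx j) f z + 'i%C * Dc (dy j) f z).

(* the column vector (d rho / d z_j)_j; L *m del rho z is (del rho)(L) for a
   (1,0)-vector L, written as a row vector *)
Definition del rho (z : Cspace R n) : 'cV[R[i]]_n :=
  \col_j d_z j (fun w => (rho w)%:C) z.

(* the matrix (d^2 rho / d z_j d zbar_k)_(j, k), i.e. i del delbar rho *)
Definition complex_hessian rho (z : Cspace R n) : 'M[R[i]]_n :=
  \matrix_(j, k) d_z j (d_zbar k (fun w => (rho w)%:C)) z.

End ComplexDerivatives.

Section Functions.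
Context {R : realType} {n : nat}.
Implicit Types (rho phi : Cspace R n -> R) (Omega : set (Cspace R n)).

Definition boundary Omega : set (Cspace R n) :=
  closure Omega `\` interior Omega.

Definition bounded_domain Omega :=
  [/\ Omega !=set0, open Omega, connected Omega & bounded_set Omega].

Definition smooth_defining_function rho Omega :=
  [/\ smooth setT rho, Omega = [set z | rho z < 0] &
      forall z, boundary Omega z -> exists v, 'D_v rho z != 0].

Definition sqnorm_fun (z : Cspace R n) : R :=
  \sum_(j < n) (z.1 0 j ^+ 2 + z.2 0 j ^+ 2).

Definition strictly_plurisubharmonic phi :=
  smooth setT phi /\
  forall z (L : 'rV[R[i]]_n), L != 0 ->
    0 < (L *m complex_hessian phi z *m L ^t*) 0 0.

Definition exhaustion phi := forall c : R, precompact [set z | phi z < c].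

End Functions.

Section WeakZ.
Context {R : realType} {n : nat}.
Implicit Types (rho phi : Cspace R n.+1 -> R) (Omega : set (Cspace R n.+1)).

(* the rows of F form a basis of T^{1,0}_z(bOmega) *)
Definition is_frame rho (z : Cspace R n.+1) (F : 'M[R[i]]_(n, n.+1)) :=
  row_free F /\ F *m del rho z = 0.

(* the entries (i del delbar phi)(i Lbar_k /\ L_j), at row j and column k, in
   the frame given by the rows L_j of F *)
Definition frame_mx phi (z : Cspace R n.+1) (F : 'M[R[i]]_(n, n.+1)) :
  'M[R[i]]_n := F *m complex_hessian phi z *m F ^t*.

(* eta(Upsilon) = \sum b^{kbar j} eta_{j kbar}; the entry b^{kbar j} is at row k
   and column j of b *)
Definition pairing (eta b : 'M[R[i]]_n) : R[i] :=
  \sum_k \sum_j b k j * eta j k.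

(* the coefficients of i theta /\ thetabar, theta being given by its values
   theta_j on the frame *)
Definition i_theta_thetabar (theta : 'rV[R[i]]_n) : 'M[R[i]]_n :=
  \matrix_(j, k) (theta 0 j * (theta 0 k)^*).

(* the dual metric, G being the Gram matrix of the frame *)
Definition sqnorm_form (G : 'M[R[i]]_n) (theta : 'rV[R[i]]_n) : R[i] :=
  \sum_k \sum_j invmx G k j * (theta 0 j * (theta 0 k)^*).

(* The increasing list, with multiplicity, of the eigenvalues of the hermitian
   form A with respect to the metric G, i.e. of the endomorphism S with
   A(L, L') = G(S L, L'), whose matrix is A G^-1. They are real, so that taking
   real parts only changes their type. *)
Definition relative_eigenvalues (A G : 'M[R[i]]_n) : seq R :=
  sort <=%R [seq complex.Re x
            | x <- sval (closed_field_poly_normal (char_poly (A *m invmx G)))].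

(* Upsilon = i \sum b^{kbar j} Lbar_k /\ L_j, where the rows of F are the L_j, has
   the coefficients F^* b F with respect to the vectors d/dzbar_k /\ d/dz_j. *)
Definition vector11 (F : 'M[R[i]]_(n, n.+1)) (b : 'M[R[i]]_n) :
  'M[R[i]]_n.+1 := F ^t* *m b *m F.

(* smooth real sections of T^{1,1}(bOmega) *)
Definition real_section11 rho Omega (U : Cspace R n.+1 -> 'M[R[i]]_n.+1) :=
  forall p, boundary Omega p ->
  exists V (F : Cspace R n.+1 -> 'M[R[i]]_(n, n.+1))
           (b : Cspace R n.+1 -> 'M[R[i]]_n),
    [/\ open V, V p, smooth_mx V F, smooth_mx V b &
        forall z, V z -> boundary Omega z ->
          [/\ is_frame rho z (F z), b z \is hermsymmx &
              U z = vector11 (F z) (b z)]].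

Definition weakZ (q : nat) rho Omega phi :=
  exists2 U, real_section11 rho Omega U &
  forall z F b, boundary Omega z -> is_frame rho z F -> U z = vector11 F b ->
    let levi := frame_mx rho z F in
    let omega := frame_mx phi z F in
    let mu := relative_eigenvalues levi omega in
    [/\ forall theta : 'rV[R[i]]_n,
          0 <= pairing (i_theta_thetabar theta) b <= sqnorm_form omega theta,
        0 <= (\sum_(j < q) mu`_j)%:C - pairing levi b &
        pairing omega b != q%:R].

End WeakZ.

(* Main.v *)
Require Import Defs.
From HB Require Import structures.
From mathcomp Require Import all_boot all_order all_algebra.
From mathcomp Require Import complex ring lra.
From mathcomp Require Import all_classical all_reals all_analysis.

(** In the linear coordinates w1 = z1, w2 = z1 + z2, w3 = z3, w4 = z4 of C^4,
    put r_j = |w_j|^2 and s = r1 + r2 + r3, and take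
      rho = r4 - 1 + r2^2 - r1^2 + s^3,   phi = 160 r1 + 8 (r2 + r3) + r4.
    The term s^3 makes Omega = {rho < 0} bounded. A segment from the origin to a
    point where rho <= 0 lies in Omega, its end excepted, so that Omega is
    connected, and the derivative of rho along it is positive at boundary points.

    At the pole w = (0, 0, 0, 1) the tangent space is {dw4 = 0}. Near it the
    Levi form is - 4 r1 |dw1|^2 + 4 r2 |dw2|^2 up to a positive term of size
    s^2, and it vanishes at the pole. Along the curve w2 = w3 = 0 the condition
    mu_1 + mu_2 >= L(Upsilon) reads, to leading order,
    Upsilon(dw1, dw1) >= |dw1|^2, so that at the pole dw1 is an eigenvector of
    Upsilon, relative to the dual metric, for the greatest allowed eigenvalue 1
    [axis1_dual]. Along w1 = w3 = 0 it reads Upsilon(dw2, dw2) <= 0, so that dw2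
    is an eigenvector for the least allowed eigenvalue 0 [axis2_dual].
    Eigenvectors for 1 and 0 are orthogonal. Since dw1 and dw2 are not
    orthogonal for the Euclidean metric, no Upsilon exists for it
    [dual_bounds_gap, not_weakZ_euclidean]; for phi they are orthogonal.

    For phi, a vector Upsilon of rank one suffices: up to a weight, it is the
    square of the tangential field whose only components are those along w1 and
    w4, and the weight 1 / (160 (1 + r1^2)) makes the square of its length at
    most 1. The sum mu_1 + mu_2 is L(u, u) + L(v, v) for an orthonormal pair
    u, v of tangent vectors, and Bessel's inequality bounds the mass of the pair
    along w1; this gives
      mu_1 + mu_2 >= (3 s^2 - 4 r1) / 160 + 3 s^2 / 8  [eigen_sum_bound].
    The term s^3 of rho is what leaves room here: it contributes 3 s^2 / 8 in
    each of the directions w2, w3 and at most 9 s^2 / 160 in the direction w1,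
    and the difference absorbs the coupling to w4 [field_levi_bound].

    The Levi forms are computed through a syntax for polynomials in z and its
    conjugate: their derivatives in the sense of limits are the formal ones
    [d_z_ceval, d_zbar_ceval, hessian_sesqui]. *)

Set Implicit Arguments.
Unset Strict Implicit.
Unset Printing Implicit Defensive.

Import Order.TTheory GRing.Theory Num.Theory.
Import numFieldNormedType.Exports.

Local Open Scope classical_set_scope.
Local Open Scope ring_scope.
Local Open Scope complex_scope.
Local Open Scope sesquilinear_scope.

(** * Hermitian matrices and relative eigenvalues *)

Section Algebra.
Variable C : numClosedFieldType.

Lemma trmxCM m n p (A : 'M[C]_(m, n)) (B : 'M[C]_(n, p)) :
  (A *m B) ^t* = B ^t* *m A ^t*.
Proof. by rewrite trmx_mul map_mxM. Qed.

Lemma trmxCZ m n (c : C) (A : 'M[C]_(m, n)) :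
  (c *: A) ^t* = Num.conj c *: A ^t*.
Proof. by apply/matrixP => i j; rewrite !mxE rmorphM. Qed.

Lemma hermsymP n (A : 'M[C]_n) : reflect (A = A ^t*) (A \is hermsymmx).
Proof.
apply: (iffP (is_hermitianmxP _ _ _)); by rewrite expr0 scale1r.
Qed.

Lemma congr_hermsym m n (A : 'M[C]_n) (Q : 'M[C]_(m, n)) :
  A \is hermsymmx -> Q *m A *m Q ^t* \is hermsymmx.
Proof.
move=> /hermsymP hA; apply/hermsymP.
by rewrite !trmxCM trmxCK -hA mulmxA.
Qed.

Lemma hermsym_unitary_diag n (A : 'M[C]_n) : A \is hermsymmx ->
  exists (P : 'M[C]_n) (d : 'rV[C]_n), [/\ P \is unitarymx, P *m A *m P ^t* = diag_mx d &
    forall i, d 0 i \is Num.real].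
Proof.
move=> hA; exists (spectralmx A), (spectral_diag A).
have Pu := spectral_unitarymx A.
split=> //; last by move=> i; have /mxOverP := hermitian_spectral_diag_real hA.
have /orthomx_spectralP e := hermitian_normalmx hA.
rewrite [X in _ *m X *m _]e -(invmx_unitary Pu) !mulmxA.
by rewrite mulmxV ?unitarymx_unit// mul1mx mulmxK ?unitarymx_unit.
Qed.

(** The frame diagonalising A with respect to the metric G: its rows are
    G-orthonormal and A-orthogonal. *)
Lemma simultaneous_diag n (A G : 'M[C]_n) :
  A \is hermsymmx -> G \is hermsymmx ->
  (forall x : 'rV[C]_n, x != 0 -> 0 < (x *m G *m x ^t*) 0 0) ->
  exists (Q : 'M[C]_n) (d : 'rV[C]_n), [/\ Q \in unitmx, Q *m G *m Q ^t* = 1%:M,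
    Q *m A *m Q ^t* = diag_mx d & forall i, d 0 i \is Num.real].
Proof.
move=> hA hG Gpos.
have [P [g [Pu PG _]]] := hermsym_unitary_diag hG.
have g0 i : 0 < g 0 i.
  have : row i P != 0.
    apply/eqP => e; have /unitarymxP/matrixP/(_ i i) := Pu.
    rewrite !mxE eqxx => s; have : (1 : C) != 0 by exact: oner_neq0.
    rewrite -[1]/(true%:R) -s big1 ?eqxx// => k _.
    by have /rowP/(_ k) := e; rewrite !mxE => ->; rewrite mul0r.
  move=> /Gpos; rewrite -row_mul.
  suff -> : (row i (P *m G) *m (row i P) ^t*) 0 0 = g 0 i by [].
  have /matrixP/(_ i i) := PG; rewrite [in RHS]mxE eqxx mulr1n => <-.
  by rewrite !mxE; apply: eq_bigr => k _; rewrite !mxE.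
(* rescaling an orthonormal eigenbasis of G makes it G-orthonormal *)
pose h : 'rV[C]_n := \row_i (sqrtC (g 0 i))^-1.
have hh : diag_mx h *m diag_mx g *m (diag_mx h) ^t* = 1%:M.
  rewrite tr_diag_mx map_diag_mx !mulmx_diag.
  apply/matrixP => i j; rewrite !mxE; congr (_ *+ _).
  have s0 : sqrtC (g 0 i) != 0 by rewrite sqrtC_eq0 gt_eqF.
  transitivity ((sqrtC (g 0 i))^-1 * g 0 i * (sqrtC (g 0 i))^-1).
    congr (_ * _); apply: conj_Creal.
    by rewrite ger0_real// invr_ge0 sqrtC_ge0 ltW.
  by apply: (mulfI s0); apply: (mulfI s0); rewrite mulr1 -expr2 sqrtCK; field.
pose Q1 := diag_mx h *m P.
have Q1G : Q1 *m G *m Q1 ^t* = 1%:M.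
  by rewrite -hh /Q1 trmxCM -PG !mulmxA.
have [P2 [d [P2u PA dr]]] := hermsym_unitary_diag (congr_hermsym Q1 hA).
have QG : P2 *m Q1 *m G *m (P2 *m Q1) ^t* = 1%:M.
  have /unitarymxP e := P2u.
  rewrite trmxCM.
  transitivity (P2 *m (Q1 *m G *m Q1 ^t*) *m P2 ^t*); first by rewrite !mulmxA.
  by rewrite Q1G mulmx1.
exists (P2 *m Q1), d; split=> //.
  by have := mulmx1_unit QG; rewrite unitmx_mul => -[/andP[]].
by rewrite trmxCM !mulmxA -PA !mulmxA.
Qed.

End Algebra.

Lemma char_poly_conj (F : fieldType) n (P D : 'M[F]_n) : P \in unitmx ->
  char_poly (invmx P *m D *m P) = char_poly D.
Proof.
move=> Pu; rewrite /char_poly /char_poly_mx !map_mxM.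
set Pp := map_mx polyC P; set Pi := map_mx polyC (invmx P).
have PiP : Pi *m Pp = 1%:M by rewrite -map_mxM mulVmx// map_mx1.
have -> : 'X%:M - Pi *m map_mx polyC D *m Pp =
    Pi *m ('X%:M - map_mx polyC D) *m Pp.
  rewrite mulmxBr mulmxBl; congr (_ - _).
  by rewrite scalar_mxC -mulmxA PiP mulmx1.
by rewrite !det_mulmx mulrC mulrA -det_mulmx (mulmx1C PiP) det1 mul1r.
Qed.

Section Diagonalised.
Variables (C : numClosedFieldType) (n : nat) (A G Q : 'M[C]_n) (d : 'rV[C]_n).
Hypotheses (Qu : Q \in unitmx) (QG : Q *m G *m Q ^t* = 1%:M).
Hypothesis QA : Q *m A *m Q ^t* = diag_mx d.

Lemma invmx_diagonalised : invmx G = Q ^t* *m Q.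
Proof.
have Qsu : Q ^t* \in unitmx by have [] := mulmx1_unit QG.
have : Q ^t* *m Q *m G = 1%:M by rewrite -mulmxA; apply: mulmx1C.
move=> e; have [_ Gu] := mulmx1_unit e.
by rewrite -[RHS]mulmx1 -(mulmxV Gu) mulmxA e mul1mx.
Qed.

Lemma mul_invmx_diagonalised : A *m invmx G = invmx Q *m diag_mx d *m Q.
Proof.
have e : invmx Q *m (Q *m A *m Q ^t*) = A *m Q ^t*.
  by rewrite -mulmxA mulKmx.
by rewrite invmx_diagonalised mulmxA -e QA.
Qed.

(** In an orthonormal diagonalising frame the endomorphism attached to A is
    diagonal, and passing to that frame is a similarity. *)
Lemma char_poly_diagonalised : char_poly (A *m invmx G) =
  \prod_(x <- [seq d 0 i | i <- enum 'I_n]) ('X - x%:P).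
Proof.
rewrite mul_invmx_diagonalised char_poly_conj//.
rewrite char_poly_trig ?diag_mx_is_trig// big_map big_enum.
by apply: eq_bigr => i _; rewrite mxE eqxx mulr1n.
Qed.

End Diagonalised.

(** The roots of a split polynomial are unique up to order, and sorting
    forgets the order; so any diagonalising frame computes the spectrum. *)
Lemma relative_eigenvalues_diag (R : realType) n (A G Q : 'M[R[i]]_n)
    (d : 'rV[R[i]]_n) :
  Q \in unitmx -> Q *m G *m Q ^t* = 1%:M -> Q *m A *m Q ^t* = diag_mx d ->
  relative_eigenvalues A G =
  sort <=%R [seq complex.Re (d 0 i) | i <- enum 'I_n].
Proof.
move=> Qu QG QA; have cE := char_poly_diagonalised Qu QG QA.
rewrite /relative_eigenvalues; case: closed_field_poly_normal => r /= re.
have {re} : perm_eq r [seq d 0 i | i <- enum 'I_n].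
  apply: prod_XsubC_eq; rewrite -cE re.
  have /monicP -> := char_poly_monic (A *m invmx G).
  by rewrite scale1r.
move=> /(perm_map (@complex.Re R)); rewrite -map_comp => e.
apply/perm_sortP => //.
- exact: le_total.
- exact: le_trans.
- exact: le_anti.
Qed.

(** Leaving out one greatest value gives the sum of all the others. This
    single description serves both for bounding the sum below, as the sum over
    the indices other than k0, and for bounding it above, by k0 being greatest. *)
Lemma sum_smallest (R : realType) n (d : 'I_n.+1 -> R) :
  exists2 k0, (forall k, d k <= d k0) &
  \sum_(j < n) (sort <=%R [seq d i | i <- enum 'I_n.+1])`_j =
  \sum_i d i - d k0.
Proof.
set s0 := [seq d i | i <- _]; set s := sort _ _.
have ps : perm_eq s s0 by apply/permPl/perm_sort.
have sz : size s = n.+1 by rewrite size_sort size_map size_enum_ord.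
have sumE : \sum_(j < n.+1) s`_j = \sum_i d i.
  have := perm_big _ ps (op := +%R) (x := 0) (F := id) (P := xpredT).
  by rewrite (big_nth 0) sz big_mkord /s0 big_map big_enum.
have : s`_n \in s0 by rewrite -(perm_mem ps) mem_nth// sz.
move=> /mapP[k0 _ k0E]; exists k0.
  move=> k; rewrite -k0E.
  have : d k \in s by rewrite (perm_mem ps) map_f// mem_enum.
  move=> dks; rewrite -(nth_index 0 dks).
  have ile : (index (d k) s <= n)%N by rewrite -ltnS -sz index_mem.
  have ss : sorted <=%R s by apply: sort_sorted; exact: le_total.
  by apply: (sorted_leq_nth le_trans le_refl 0 ss); rewrite ?inE ?sz.
by rewrite -sumE big_ord_recr /= -k0E addrK.
Qed.

Section Frames.
Variables (C : numClosedFieldType) (n : nat).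
Implicit Types (F : 'M[C]_(n, n.+1)) (a : 'cV[C]_n.+1) (H : 'M[C]_n.+1).

(** The frame and the kernel of a have the same dimension, so they span the
    same space. *)
Lemma frame_span F a (u : 'rV[C]_n.+1) : row_free F -> F *m a = 0 -> a != 0 ->
  u *m a = 0 -> exists c : 'rV[C]_n, u = c *m F.
Proof.
move=> Ff Fa a0 ua.
have FK : (F <= kermx a)%MS by apply/sub_kermxP.
have uK : (u <= kermx a)%MS by apply/sub_kermxP.
have ra : \rank a = 1%N.
  apply/eqP; rewrite eqn_leq rank_leq_col lt0n mxrank_eq0 a0 //.
have KF : (kermx a <= F)%MS.
  have [_ /esym e] := mxrank_leqif_sup FK.
  by rewrite e mxrank_ker ra subn1 /= (eqP Ff).
by have /submxP[c ->] := submx_trans uK KF; exists c.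
Qed.

Lemma frame_gram_pos F H :
  (forall L : 'rV[C]_n.+1, L != 0 -> 0 < (L *m H *m L ^t*) 0 0) -> row_free F ->
  forall x : 'rV[C]_n, x != 0 -> 0 < (x *m (F *m H *m F ^t*) *m x ^t*) 0 0.
Proof.
move=> Hp Ff x x0; have /Hp : x *m F != 0.
  apply: contra x0 => /eqP e; rewrite -(mul0mx _ F) in e.
  by rewrite (row_free_inj Ff e).
by rewrite trmxCM !mulmxA.
Qed.

Lemma frame_coefs_eq F (b b' : 'M[C]_n) : row_free F ->
  F ^t* *m b *m F = F ^t* *m b' *m F -> b = b'.
Proof.
move=> Ff /(row_free_inj Ff) /(congr1 (fun X => X ^t*)).
rewrite !trmxCM !trmxCK => /(row_free_inj Ff) /(congr1 (fun X => X ^t*)).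
by rewrite !trmxCK.
Qed.

End Frames.

Lemma trace_rank1 (C : numClosedFieldType) n (eta : 'M[C]_n) (p : C)
    (c : 'rV[C]_n) :
  \tr (p *: (c ^t* *m c) *m eta) = p * (c *m eta *m c ^t*) 0 0.
Proof.
rewrite -scalemxAl mxtraceZ -[_ *m c *m eta]mulmxA mxtrace_mulC.
by rewrite trace_mx11.
Qed.

Section Pairing.
Variables (R : realType) (n : nat).
Implicit Types (eta b G : 'M[R[i]]_n) (theta c : 'rV[R[i]]_n).

Lemma pairingE eta b : pairing eta b = \tr (b *m eta).
Proof.
rewrite /pairing /mxtrace; apply: eq_bigr => k _.
by rewrite mxE.
Qed.

Lemma i_theta_thetabarE theta :
  i_theta_thetabar theta = theta ^T *m (theta ^T) ^t*.
Proof. by apply/matrixP => j k; rewrite !mxE big_ord1 !mxE. Qed.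

Lemma pairing_i_theta b theta :
  pairing (i_theta_thetabar theta) b =
  ((theta ^T) ^t* *m b *m theta ^T) 0 0.
Proof.
by rewrite pairingE i_theta_thetabarE mulmxA mxtrace_mulC mulmxA trace_mx11.
Qed.

Lemma sqnorm_formE G theta :
  sqnorm_form G theta = ((theta ^T) ^t* *m invmx G *m theta ^T) 0 0.
Proof.
rewrite -pairing_i_theta /sqnorm_form /pairing; apply: eq_bigr => k _.
by apply: eq_bigr => j _; rewrite !mxE.
Qed.

Lemma pairing_rank1 eta (p : R[i]) c :
  pairing eta (p *: (c ^t* *m c)) = p * (c *m eta *m c ^t*) 0 0.
Proof. by rewrite pairingE trace_rank1. Qed.

End Pairing.

Section RankOne.
Variables (C : numClosedFieldType) (n : nat) (G Q : 'M[C]_n).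
Hypotheses (Qu : Q \in unitmx) (QG : Q *m G *m Q ^t* = 1%:M).

(** Cauchy-Schwarz, in the coordinates of a G-orthonormal frame: a multiple of
    a vector of length at most 1 has a square below the dual metric. *)
Lemma rank1_dual_bounds (p : C) (c : 'rV[C]_n) (t : 'cV[C]_n) : 0 <= p ->
  p * (c *m G *m c ^t*) 0 0 <= 1 ->
  0 <= (t ^t* *m (p *: (c ^t* *m c)) *m t) 0 0 <=
    (t ^t* *m invmx G *m t) 0 0.
Proof.
move=> p0 pc; set w := (Q *m t) ^t*.
have [c' cE] : exists c', c = c' *m Q by exists (c *m invmx Q); rewrite mulmxKV.
have nc : dotmx c' c' = (c *m G *m c ^t*) 0 0.
  rewrite dotmxE cE trmxCM.
  suff -> : c' *m Q *m G *m (Q ^t* *m c' ^t*) = c' *m (Q *m G *m Q ^t*) *m c' ^t*.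
    by rewrite QG mulmx1.
  by rewrite !mulmxA.
have nw : (t ^t* *m invmx G *m t) 0 0 = dotmx w w.
  by rewrite dotmxE (invmx_diagonalised QG) trmxCK /w trmxCM !mulmxA.
have yE : dotmx c' w = (c *m t) 0 0.
  by rewrite dotmxE /w trmxCK mulmxA -cE.
have -> : (t ^t* *m (p *: (c ^t* *m c)) *m t) 0 0 = p * `|dotmx c' w| ^+ 2.
  rewrite -scalemxAr -scalemxAl mxE yE; congr (_ * _).
  have -> : t ^t* *m (c ^t* *m c) *m t = (c *m t) ^t* *m (c *m t).
    by rewrite trmxCM !mulmxA.
  by rewrite mxE big_ord1 !mxE normCKC.
rewrite mulr_ge0 ?exprn_ge0//= nw.
have [/(ler_wpM2l p0) h _] := CauchySchwarz (@dotmx C n) c' w.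
apply: (le_trans h); rewrite mulrA.
have w0 : 0 <= dotmx w w by exact: (dnorm_ge0 (@dotmx C n) w).
apply: (le_trans (ler_wpM2r w0 (_ : p * dotmx c' c' <= 1))); last by rewrite mul1r.
by rewrite nc.
Qed.

End RankOne.

Section FrameCoordinates.
Variables (C : numClosedFieldType) (n : nat).
Variables (F : 'M[C]_(n, n.+1)) (a : 'cV[C]_n.+1) (H : 'M[C]_n.+1).
Hypotheses (Ff : row_free F) (Fa : F *m a = 0) (a0 : a != 0).

(** Row freeness makes the coefficients of a (1,1)-vector in a frame unique,
    so they can be read off from the coordinates of K. *)
Lemma rank1_frame (K : 'rV[C]_n.+1) (p : C) (b : 'M[C]_n) : K *m a = 0 ->
  p *: (K ^t* *m K) = F ^t* *m b *m F ->
  exists2 c : 'rV[C]_n, K = c *m F & b = p *: (c ^t* *m c).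
Proof.
move=> Ka e; have [c Kc] := frame_span Ff Fa a0 Ka.
exists c => //; apply: (frame_coefs_eq Ff); rewrite -e Kc trmxCM.
by rewrite -scalemxAr -scalemxAl !mulmxA.
Qed.

Lemma frame_form (c : 'rV[C]_n) :
  c *m (F *m H *m F ^t*) *m c ^t* = c *m F *m H *m (c *m F) ^t*.
Proof. by rewrite trmxCM !mulmxA. Qed.

(** Both sides are the orthogonal projection to the tangent space: the
    difference kills the conormal a, so its rows are tangent, and it also kills
    the frame. *)
Lemma frame_projection : F *m F ^t* \in unitmx ->
  F ^t* *m invmx (F *m F ^t*) *m F =
  1%:M - ((a ^t* *m a) 0 0)^-1 *: (a *m a ^t*).
Proof.
move=> Gu.
have na0 : (a ^t* *m a) 0 0 != 0.
  have : a ^t* != 0.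
    by apply: contra a0 => /eqP e; rewrite -(trmxCK a) e trmx0 map_mx0.
  by move=> /(@dotmx_is_dotmx C _); rewrite dotmxE trmxCK => /gt_eqF ->.
set P := F ^t* *m _ *m F; set r := (a ^t* *m a) 0 0.
pose S := 1%:M - r^-1 *: (a *m a ^t*) - P.
have Sa : S *m a = 0.
  rewrite 2!mulmxBl mul1mx -scalemxAl -!mulmxA Fa !mulmx0 subr0.
  have -> : a ^t* *m a = r%:M by exact: mx11_scalar.
  by rewrite mul_mx_scalar scalerA mulVf// scale1r subrr.
have SF : S *m F ^t* = 0.
  rewrite 2!mulmxBl mul1mx -scalemxAl -!mulmxA mulVmx// mulmx1.
  by rewrite -trmxCM Fa trmx0 map_mx0 mulmx0 scaler0 subr0 subrr.
have S0 : S = 0.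
  apply/row_matrixP => i; rewrite row0.
  have ra : row i S *m a = 0 by rewrite -row_mul Sa row0.
  have [c cE] := frame_span Ff Fa a0 ra.
  have : row i S *m F ^t* = 0 by rewrite -row_mul SF row0.
  rewrite cE -mulmxA => /(congr1 (mulmx^~ (invmx (F *m F ^t*)))).
  by rewrite mulmxK// mul0mx => ->; rewrite mul0mx.
by apply/esym/eqP; rewrite -subr_eq0; apply/eqP.
Qed.
End FrameCoordinates.

(** * Weak Z(2) at a point: rank one vectors and the Euclidean metric *)

Lemma row_form (C : numClosedFieldType) m n (Q : 'M[C]_(m, n)) (X : 'M[C]_n)
    i j :
  (row i Q *m X *m (row j Q) ^t*) 0 0 = (Q *m X *m Q ^t*) i j.
Proof.
rewrite -row_mul !mxE; apply: eq_bigr => k _.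
by rewrite !mxE.
Qed.

Lemma diagonal_frame (C : numClosedFieldType) n (F : 'M[C]_(n, n.+1))
    (L H : 'M[C]_n.+1) : L \is hermsymmx -> H \is hermsymmx ->
  (forall x : 'rV[C]_n.+1, x != 0 -> 0 < (x *m H *m x ^t*) 0 0) ->
  row_free F ->
  exists (Q : 'M[C]_n) (d : 'rV[C]_n),
    [/\ Q \in unitmx, Q *m (F *m H *m F ^t*) *m Q ^t* = 1%:M,
        Q *m (F *m L *m F ^t*) *m Q ^t* = diag_mx d &
        forall i, d 0 i \is Num.real].
Proof.
move=> hL hH Hp Ff; apply: simultaneous_diag.
- exact: congr_hermsym.
- exact: congr_hermsym.
- exact: frame_gram_pos.
Qed.

(** The rows of Q F are the tangent vectors whose form matrix is Y. *)
Lemma form_rows_frame (C : numClosedFieldType) n (F : 'M[C]_(n, n.+1))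
    (X : 'M[C]_n.+1) (Q Y : 'M[C]_n) i j :
  Q *m (F *m X *m F ^t*) *m Q ^t* = Y ->
  (row i Q *m F *m X *m (row j Q *m F) ^t*) 0 0 = Y i j.
Proof.
by move=> <-; rewrite -(row_mul i Q F) -(row_mul j Q F) row_form trmxCM !mulmxA.
Qed.

Lemma real_complexRe (R : realType) (x : R[i]) :
  x \is Num.real -> (complex.Re x)%:C = x.
Proof.
by case: x => a b; rewrite realE !lecE /= => /orP[] /andP[/eqP h _] /=; rewrite -?h // h.
Qed.

Section RankOneWeakZ.
Variables (R : realType).
Variables (F : 'M[R[i]]_(3, 4)) (a : 'cV[R[i]]_4) (L H : 'M[R[i]]_4).
Hypotheses (Ff : row_free F) (Fa : F *m a = 0) (a0 : a != 0).
Hypotheses (hL : L \is hermsymmx) (hH : H \is hermsymmx).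
Hypothesis Hp : forall x : 'rV[R[i]]_4, x != 0 -> 0 < (x *m H *m x ^t*) 0 0.

Let levi := F *m L *m F ^t*.
Let omega := F *m H *m F ^t*.
Let mu := relative_eigenvalues levi omega.

(** Here mu_1 + mu_2 is attained on two rows of an orthonormal diagonalising
    frame, so a bound over all orthonormal tangent pairs is enough; and the trace
    of Upsilon, being at most 1, cannot be 2. *)
Lemma rank1_weakZ (b : 'M[R[i]]_3) (K : 'rV[R[i]]_4) (p : R[i]) :
  K *m a = 0 -> 0 <= p -> p * (K *m H *m K ^t*) 0 0 <= 1 ->
  p *: (K ^t* *m K) = F ^t* *m b *m F ->
  (forall u v : 'rV[R[i]]_4, u *m a = 0 -> v *m a = 0 ->
    (u *m H *m u ^t*) 0 0 = 1 -> (v *m H *m v ^t*) 0 0 = 1 ->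
    (u *m H *m v ^t*) 0 0 = 0 ->
    p * (K *m L *m K ^t*) 0 0 <=
    (u *m L *m u ^t*) 0 0 + (v *m L *m v ^t*) 0 0) ->
  [/\ forall theta : 'rV[R[i]]_3,
        0 <= pairing (i_theta_thetabar theta) b <= sqnorm_form omega theta,
      0 <= (\sum_(j < 2) mu`_j)%:C - pairing levi b &
      pairing omega b != 2%:R].
Proof.
move=> Ka p0 pH eb pL.
have [Q [d [Qu QG QA dr]]] := diagonal_frame hL hH Hp Ff.
have [c Kc bE] := rank1_frame Ff Fa a0 Ka eb.
have pc : p * (c *m omega *m c ^t*) 0 0 <= 1 by rewrite frame_form -Kc.
split.
- move=> theta; rewrite pairing_i_theta sqnorm_formE bE.
  exact: (rank1_dual_bounds Qu QG).
- rewrite subr_ge0 bE pairing_rank1 frame_form -Kc /mu.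
  rewrite (relative_eigenvalues_diag Qu QG QA).
  have [k0 _ ->] := sum_smallest (fun i => complex.Re (d 0 i)).
  rewrite (bigD1_ord k0) //= addrAC subrr add0r !big_ord_recl big_ord0 addr0.
  set i := lift k0 _; set j := lift k0 _.
  rewrite rmorphD /= !real_complexRe//.
  have e k : d 0 k = (row k Q *m F *m L *m (row k Q *m F) ^t*) 0 0.
    by rewrite (form_rows_frame _ _ QA) mxE eqxx.
  rewrite (e i) (e j).
  have T k : row k Q *m F *m a = 0 by rewrite -mulmxA Fa mulmx0.
  have ij : i != j by rewrite (inj_eq (@lift_inj _ k0)).
  apply: pL; rewrite ?T// (form_rows_frame _ _ QG) mxE ?eqxx//.
  by rewrite (negPf ij).
- rewrite bE pairing_rank1; apply/eqP => e; move: pc; rewrite e.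
  by rewrite (ler_nat _ 2 1).
Qed.

End RankOneWeakZ.

Section EuclideanObstruction.
Variables (C : numClosedFieldType) (n : nat).
Variables (F : 'M[C]_(n, n.+1)) (a : 'cV[C]_n.+1) (L : 'M[C]_n.+1).
Hypotheses (Ff : row_free F) (Fa : F *m a = 0) (a0 : a != 0).

(** The tangential part of a covector is not longer than the covector. *)
Lemma projection_form_le (t : 'cV[C]_n.+1) :
  F *m F ^t* \in unitmx ->
  ((F *m t) ^t* *m invmx (F *m F ^t*) *m (F *m t)) 0 0 <= (t ^t* *m t) 0 0.
Proof.
move=> Gu; rewrite trmxCM.
have -> : t ^t* *m F ^t* *m invmx (F *m F ^t*) *m (F *m t) =
    t ^t* *m (F ^t* *m invmx (F *m F ^t*) *m F) *m t by rewrite !mulmxA.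
rewrite (frame_projection Ff Fa a0 Gu) mulmxBr mulmx1 mulmxBl [leLHS]mxE.
rewrite gerDl mxE oppr_le0 -scalemxAr -scalemxAl mxE mulr_ge0//.
  rewrite invr_ge0 -{2}(trmxCK a) -dotmxE.
  exact: (dnorm_ge0 (@dotmx C _)).
have -> : t ^t* *m (a *m a ^t*) *m t = (t ^t* *m a) *m (t ^t* *m a) ^t*.
  by rewrite trmxCM trmxCK !mulmxA.
by rewrite -dotmxE; exact: (dnorm_ge0 (@dotmx C _)).
Qed.

Variables (Q : 'M[C]_n) (d : 'rV[C]_n).
Hypotheses (Qu : Q \in unitmx) (QG : Q *m (F *m F ^t*) *m Q ^t* = 1%:M).
Hypothesis QA : Q *m (F *m L *m F ^t*) *m Q ^t* = diag_mx d.

(** The trace of the tangential part of L is the trace of L minus its value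
    on the unit conormal. *)
Lemma sum_eigenvalues : \sum_i d 0 i =
  \tr L - (a ^t* *m L *m a) 0 0 / (a ^t* *m a) 0 0.
Proof.
have Gu : F *m F ^t* \in unitmx.
  have [+ _] := mulmx1_unit QG.
  by rewrite unitmx_mul => /andP[].
have -> : \sum_i d 0 i = \tr (diag_mx d).
  by apply: eq_bigr => i _; rewrite mxE eqxx.
have -> : \tr (diag_mx d) = \tr (F *m L *m F ^t* *m invmx (F *m F ^t*)).
  by rewrite (mul_invmx_diagonalised Qu QG QA) mxtrace_mulC mulmxA mulmxV// mul1mx.
have -> : \tr (F *m L *m F ^t* *m invmx (F *m F ^t*)) =
    \tr (L *m (F ^t* *m invmx (F *m F ^t*) *m F)).
  by rewrite -!mulmxA mxtrace_mulC !mulmxA.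
rewrite (frame_projection Ff Fa a0 Gu) mulmxBr mulmx1 -scalemxAr raddfB /=; congr (_ - _).
rewrite mxtraceZ mulrC; congr (_ * _).
by rewrite mulmxA mxtrace_mulC mulmxA trace_mx11.
Qed.

Lemma form_le_top_eigenvalue (M : C) (u : 'rV[C]_n.+1) : u *m a = 0 ->
  (forall i, d 0 i <= M) ->
  (u *m L *m u ^t*) 0 0 <= M * (u *m u ^t*) 0 0.
Proof.
move=> ua dM; have [c] := frame_span Ff Fa a0 ua.
have [x ->] : exists x, c = x *m Q by exists (c *m invmx Q); rewrite mulmxKV.
move=> {ua c} ->.
have -> : x *m Q *m F *m L *m (x *m Q *m F) ^t* = x *m diag_mx d *m x ^t*.
  by rewrite -QA !trmxCM !mulmxA.
have -> : x *m Q *m F *m (x *m Q *m F) ^t* = x *m x ^t*.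
  transitivity (x *m (Q *m (F *m F ^t*) *m Q ^t*) *m x ^t*).
    by rewrite !trmxCM !mulmxA.
  by rewrite QG mulmx1.
rewrite mul_mx_diag [leLHS]mxE [X in _ * X]mxE mulr_sumr ler_sum// => i _.
rewrite !mxE mulrAC [_ * d _ _]mulrC ler_wpM2r// ?mul_conjC_ge0//.
Qed.

End EuclideanObstruction.

Section EuclideanWeakZ.
Variables (R : realType).
Variables (F : 'M[R[i]]_(3, 4)) (a : 'cV[R[i]]_4) (L : 'M[R[i]]_4).
Hypotheses (Ff : row_free F) (Fa : F *m a = 0) (a0 : a != 0).
Hypotheses (hL : L \is hermsymmx).

Let levi := F *m L *m F ^t*.
Let omega := F *m 1%:M *m F ^t*.
Let mu := relative_eigenvalues levi omega.
Variables (b : 'M[R[i]]_3) (U : 'M[R[i]]_4).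
Hypothesis Ub : U = F ^t* *m b *m F.

Lemma euclidean_bounds :
  (forall theta : 'rV[R[i]]_3,
     0 <= pairing (i_theta_thetabar theta) b <= sqnorm_form omega theta) ->
  forall t : 'cV[R[i]]_4,
    0 <= (t ^t* *m U *m t) 0 0 <= (t ^t* *m t) 0 0.
Proof.
move=> h t; have := h (F *m t)^T.
rewrite pairing_i_theta sqnorm_formE !trmxK /omega mulmx1.
have -> : (F *m t) ^t* *m b *m (F *m t) = t ^t* *m U *m t.
  by rewrite Ub trmxCM !mulmxA.
move=> /andP[-> /le_trans -> //].
apply: (projection_form_le Ff Fa a0).
have h1 : (1%:M : 'M[R[i]]_4) \is hermsymmx.
  by apply/hermsymP; rewrite trmx1 map_mx1.
have [|Q [d [Qu QG _ _]]] := diagonal_frame h1 h1 _ Ff.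
  by move=> x x0; rewrite mulmx1 -dotmxE dotmx_is_dotmx.
move: QG; rewrite mulmx1 => QG; have [+ _] := mulmx1_unit QG.
by rewrite unitmx_mul => /andP[].
Qed.

(** Since mu_1 + mu_2 is the tangential trace minus mu_3, and since mu_3 is
    at least the value of L on any unit tangent vector u, condition (ii) yields
    an inequality in which only traces and the value on u are left. *)
Lemma euclidean_obstruction :
  0 <= (\sum_(j < 2) mu`_j)%:C - pairing levi b ->
  forall u : 'rV[R[i]]_4, u *m a = 0 ->
    (u *m L *m u ^t*) 0 0 + (u *m u ^t*) 0 0 * \tr (U *m L) <=
    (u *m u ^t*) 0 0 *
      (\tr L - (a ^t* *m L *m a) 0 0 / (a ^t* *m a) 0 0).
Proof.
move=> + u ua; rewrite subr_ge0 pairingE.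
have -> : \tr (b *m levi) = \tr (U *m L).
  by rewrite Ub /levi mulmxA mxtrace_mulC !mulmxA.
have h1 : (1%:M : 'M[R[i]]_4) \is hermsymmx.
  by apply/hermsymP; rewrite trmx1 map_mx1.
have [|Q [d [Qu QG QA dr]]] := diagonal_frame hL h1 _ Ff.
  by move=> x x0; rewrite mulmx1 -dotmxE dotmx_is_dotmx.
rewrite /mu (relative_eigenvalues_diag Qu QG QA).
have [k0 k0P ->] := sum_smallest (fun i => complex.Re (d 0 i)).
rewrite rmorphB rmorph_sum /= real_complexRe//.
under eq_bigr do rewrite real_complexRe//.
move: QG; rewrite mulmx1 => QG.
rewrite (sum_eigenvalues Ff Fa a0 Qu QG QA) => h.
have dM i : d 0 i <= d 0 k0.
  by rewrite -(real_complexRe (dr i)) -(real_complexRe (dr k0)) lecR k0P.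
have top := form_le_top_eigenvalue Ff Fa a0 Qu QG QA ua dM.
have uu : 0 <= (u *m u ^t*) 0 0.
  by rewrite -dotmxE; exact: (dnorm_ge0 (@dotmx _ _)).
have := lerD top (ler_wpM2l uu h).
by rewrite mulrBr [d 0 k0 * _]mulrC addrCA subrr addr0.
Qed.

End EuclideanWeakZ.

(** * Closure properties of C^k functions *)

Section CkAlgebra.
Context {R : realType} {n : nat}.
Implicit Types (V : set (Cspace R n)) (f g : Cspace R n -> R).

Lemma CkW k V f : Ck k.+1 V f -> Ck k V f.
Proof.
elim: k f => [|k IH] f; first by case.
move=> [fc fd]; split=> // v; have [dv /IH] := fd v.
by split.
Qed.

Lemma sub_Ck k V f : Ck k setT f -> Ck k V f.
Proof.
elim: k f => [|k IH] f [fc fd]; split=> //.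
- by move=> x _; apply: fc; rewrite inE.
- by move=> x _; apply: fc; rewrite inE.
- move=> v; have [dv /IH ?] := fd v; split=> // x _.
  by apply: dv; rewrite inE.
Qed.

Lemma near_open V f g z : open V -> {in V, f =1 g} -> z \in V ->
  \forall w \near z, f w = g w.
Proof.
move=> oV fg; rewrite inE => Vz; near=> w.
apply: fg; rewrite inE; near: w; exact: open_nbhs_nbhs.
Unshelve. all: by end_near. Qed.

(** On an open set C^k regularity only depends on the values on that set, which
    is needed because the derivatives of products and inverses are known there
    only. *)
Lemma eq_Ck k V f g : open V -> {in V, f =1 g} -> Ck k V f -> Ck k V g.
Proof.
move=> oV; elim: k f g => [|k IH] f g fg [fc fd].
  split=> // x xV; rewrite /continuous_at -(fg x xV).
  apply: cvg_trans (fc x xV); apply: near_eq_cvg.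
  exact: (near_open oV fg xV).
split=> [x xV|v].
  rewrite /continuous_at -(fg x xV).
  apply: cvg_trans (fc x xV); apply: near_eq_cvg.
  exact: (near_open oV fg xV).
have [dv Dk] := fd v; split=> [x xV|].
  exact: (near_eq_derivable (near_open oV fg xV) (dv x xV)).
apply: IH Dk => x xV; apply: near_eq_derive.
exact: (near_open oV fg xV).
Qed.

Lemma Ck_add k V f g : open V -> Ck k V f -> Ck k V g -> Ck k V (f + g).
Proof.
move=> oV; elim: k f g => [|k IH] f g [fc fd] [gc gd].
  by split=> // x xV; apply: cvgD; [exact: fc|exact: gc].
split=> [x xV|v]; first by apply: cvgD; [exact: fc|exact: gc].
have [df Df] := fd v; have [dg Dg] := gd v.
split=> [x xV|]; first by apply: derivableD; [exact: df|exact: dg].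
apply: eq_Ck (IH _ _ Df Dg) => // x xV /=.
by rewrite deriveD; [|exact: df|exact: dg].
Qed.

Lemma Ck_mul k V f g : open V -> Ck k V f -> Ck k V g -> Ck k V (f * g).
Proof.
move=> oV; elim: k f g => [|k IH] f g fk gk.
  case: fk gk => fc _ [gc _]; split=> // x xV.
  by apply: cvgM; [exact: fc|exact: gc].
have fk' := CkW fk; have gk' := CkW gk.
case: fk gk => fc fd [gc gd].
split=> [x xV|v]; first by apply: cvgM; [exact: fc|exact: gc].
have [df Df] := fd v; have [dg Dg] := gd v.
split=> [x xV|]; first by apply: derivableM; [exact: df|exact: dg].
apply: eq_Ck (Ck_add oV (IH _ _ fk' Dg) (IH _ _ gk' Df)) => // x xV /=.
by rewrite deriveM; [|exact: df|exact: dg].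
Qed.

Lemma Ck_cst k V (c : R) : Ck k V (cst c).
Proof.
elim: k c => [|k IH] c; split=> //.
- by move=> x _; exact: cst_continuous.
- by move=> x _; exact: cst_continuous.
- move=> v; split=> [x _|]; first exact: derivable_cst.
  have -> : (fun z => 'D_v (cst c) z) = cst (0 : R).
    by apply/funext => z; rewrite derive_cst.
  exact: IH.
Qed.

(** By induction on k: the derivative of 1/f is the product of f' and of two
    factors 1/f, which are already known to be one degree less regular. *)
Lemma Ck_inv k V f : open V -> {in V, forall z, f z != 0} -> Ck k V f ->
  Ck k V (fun z => (f z)^-1).
Proof.
move=> oV f0; elim: k => [|k IH] fk.
  case: fk => fc _; split=> // x xV.
  by apply: cvgV; [exact: f0|exact: fc].
have Ik := IH (CkW fk); case: fk => fc fd.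
split=> [x xV|v]; first by apply: cvgV; [exact: f0|exact: fc].
have [df Df] := fd v.
split=> [x xV|]; first by apply: derivableV; [exact: f0|exact: df].
have := Ck_mul oV (Ck_mul oV (Ck_cst k V (-1)) (Ck_mul oV Ik Ik)) Df.
apply: eq_Ck => // x xV /=.
rewrite deriveV; [|exact: f0|exact: df].
rewrite -[RHS]/(- f x ^- 2 * 'D_v f x) -[LHS]/(-1 * ((f x)^-1 * (f x)^-1) * 'D_v f x).
by rewrite mulN1r expr2 invfM.
Qed.

End CkAlgebra.

(** * Polynomials in z and its conjugate, and their derivatives *)

Section ReIm.
Variable R : realType.
Implicit Types x y : R[i].
Lemma ReM x y : complex.Re (x * y) =
  complex.Re x * complex.Re y - complex.Im x * complex.Im y.
Proof. by case: x y => [? ?] [? ?]. Qed.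
Lemma ImM x y : complex.Im (x * y) =
  complex.Re x * complex.Im y + complex.Im x * complex.Re y.
Proof. by case: x y => [? ?] [? ?]. Qed.
Lemma ReD x y : complex.Re (x + y) = complex.Re x + complex.Re y.
Proof. by case: x y => [? ?] [? ?]. Qed.
Lemma ImD x y : complex.Im (x + y) = complex.Im x + complex.Im y.
Proof. by case: x y => [? ?] [? ?]. Qed.
Lemma conjE (a b : R) : Num.conj (a +i* b) = a -i* b.
Proof. by []. Qed.
End ReIm.

Section PolynomialFunctions.
Context {R : realType} {n : nat}.

(** Polynomials in the coordinates z_j and their conjugates, as syntax: both the
    regularity and the Wirtinger derivatives of the functions they denote follow
    by structural induction. *)
Inductive cpoly : Type :=
| PCst of R[i]
| PVar of 'I_n
| PBar of 'I_n
| PAdd of cpoly & cpoly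
| PMul of cpoly & cpoly.

Definition zcoord (z : Cspace R n) (j : 'I_n) : R[i] := z.1 0 j +i* z.2 0 j.

Fixpoint ceval (e : cpoly) (z : Cspace R n) : R[i] :=
  match e with
  | PCst c => c
  | PVar j => zcoord z j
  | PBar j => Num.conj (zcoord z j)
  | PAdd e1 e2 => ceval e1 z + ceval e2 z
  | PMul e1 e2 => ceval e1 z * ceval e2 z
  end.

(** The formal derivation that takes the value u_j on z_j and v_j on its
    conjugate. Directional derivatives, d/dz_k and d/dzbar_k are all of this
    shape. *)
Fixpoint cder (u v : 'I_n -> R[i]) (e : cpoly) : cpoly :=
  match e with
  | PCst c => PCst 0
  | PVar j => PCst (u j)
  | PBar j => PCst (v j)
  | PAdd e1 e2 => PAdd (cder u v e1) (cder u v e2)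
  | PMul e1 e2 => PAdd (PMul (cder u v e1) e2) (PMul e1 (cder u v e2))
  end.

Definition cdir (v : Cspace R n) : cpoly -> cpoly :=
  cder (zcoord v) (fun j => Num.conj (zcoord v j)).

Definition unit_at (k j : 'I_n) : R[i] := (j == k)%:R.

Definition cdz k := cder (unit_at k) (fun=> 0).
Definition cdzbar k := cder (fun=> 0) (unit_at k).

Lemma is_derive_linear (f : Cspace R n -> R) (v z : Cspace R n) :
  (forall h w, f (h *: v + w) = h * f v + f w) -> is_derive z v f (f v).
Proof.
move=> fl; suff h : h^-1 *: ((f \o shift z) (h *: v) - f z) @[h --> 0^'] --> f v.
  by apply: DeriveDef; [apply/cvg_ex; exists (f v)|exact: cvg_lim].
have e : \forall h \near 0^', f v = h^-1 *: ((f \o shift z) (h *: v) - f z).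
  near=> h; rewrite /= fl addrK -[RHS]/(h^-1 * _) mulKf//.
  by near: h; exact: nbhs_dnbhs_neq.
by apply: (cvg_trans (near_eq_cvg e)); exact: cvg_cst.
Unshelve. all: by end_near. Qed.

Lemma is_derive_ceval e (v z : Cspace R n) :
  is_derive z v (fun w => complex.Re (ceval e w)) (complex.Re (ceval (cdir v e) z)) /\
  is_derive z v (fun w => complex.Im (ceval e w)) (complex.Im (ceval (cdir v e) z)).
Proof.
elim: e => [c|j|j|e1 [d1 d1'] e2 [d2 d2']|e1 [d1 d1'] e2 [d2 d2']] /=.
- by split; [exact: (is_derive_cst (complex.Re c) z v)
            |exact: (is_derive_cst (complex.Im c) z v)].
- split; [apply: (is_derive_linear (f := fun w => w.1 0 j))|
          apply: (is_derive_linear (f := fun w => w.2 0 j))];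
    by move=> h w; rewrite /= !mxE.
- split; [apply: (is_derive_linear (f := fun w => w.1 0 j))|
          apply: (is_derive_linear (f := fun w => - w.2 0 j))];
    by move=> h w; rewrite /= !mxE ?opprD ?mulrN.
- split.
  + have := is_deriveD d1 d2; congr is_derive.
      by apply/funext => w; rewrite /= raddfD.
    by rewrite raddfD.
  + have := is_deriveD d1' d2'; congr is_derive.
      by apply/funext => w; rewrite /= raddfD.
    by rewrite raddfD.
- split.
  + have := is_deriveB (is_deriveM d1 d2) (is_deriveM d1' d2'); congr is_derive.
      by apply/funext => w; rewrite /= ReM.
    by rewrite ReD !ReM /GRing.scale /=; ring.
  + have := is_deriveD (is_deriveM d1 d2') (is_deriveM d1' d2); congr is_derive.
      by apply/funext => w; rewrite /= ImM.
    by rewrite ImD !ImM /GRing.scale /=; ring.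
Qed.

Lemma Dc_ceval v e z : Dc v (ceval e) z = ceval (cdir v e) z.
Proof.
have [d1 d2] := is_derive_ceval e v z.
by rewrite /Dc !derive_val; case: (ceval _ _).
Qed.

Lemma zcoord_dx k j : zcoord (dx k) j = unit_at k j.
Proof. by rewrite /zcoord /unit_at /= !mxE eqxx /=; case: (j == k). Qed.

Lemma zcoord_dy k j : zcoord (dy k) j = 'i%C * unit_at k j.
Proof.
rewrite /zcoord /unit_at /= !mxE eqxx /=.
by case: (j == k); rewrite ?mulr1 ?mulr0.
Qed.

Lemma conj_unit_at k j : Num.conj (unit_at k j) = unit_at k j.
Proof. exact: conjC_nat. Qed.

Lemma conj_i : Num.conj 'i%C = - 'i%C :> R[i].
Proof. by rewrite conjE; simpc. Qed.

Lemma mul_ii : 'i%C * 'i%C = -1 :> R[i].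
Proof. by rewrite -expr2 sqr_i. Qed.

Lemma d_z_ceval k e z : d_z k (ceval e) z = ceval (cdz k e) z.
Proof.
rewrite /d_z !Dc_ceval.
have two : 2 != 0 :> R[i] by rewrite pnatr_eq0.
elim: e => [c|j|j|e1 h1 e2 h2|e1 h1 e2 h2] /=.
- by rewrite mulr0 subr0 mulr0.
- by rewrite zcoord_dx zcoord_dy mulrA mul_ii; field.
- rewrite zcoord_dx zcoord_dy rmorphM /= !conj_unit_at conj_i.
  by rewrite mulrA mulrN mul_ii; field.
- by rewrite -h1 -h2; field.
- by rewrite -h1 -h2; field.
Qed.

Lemma d_zbar_ceval k e z : d_zbar k (ceval e) z = ceval (cdzbar k e) z.
Proof.
rewrite /d_zbar !Dc_ceval.
have two : 2 != 0 :> R[i] by rewrite pnatr_eq0.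
elim: e => [c|j|j|e1 h1 e2 h2|e1 h1 e2 h2] /=.
- by rewrite mulr0 addr0 mulr0.
- by rewrite zcoord_dx zcoord_dy mulrA mul_ii; field.
- rewrite zcoord_dx zcoord_dy rmorphM /= !conj_unit_at conj_i.
  by rewrite mulrA mulrN mul_ii; field.
- by rewrite -h1 -h2; field.
- by rewrite -h1 -h2; field.
Qed.

Lemma continuous_ceval e :
  continuous (fun w => complex.Re (ceval e w)) /\
  continuous (fun w => complex.Im (ceval e w)).
Proof.
have c1 j : continuous (fun w : Cspace R n => w.1 0 j).
  move=> w; apply: (@continuous_comp _ _ _ (@fst _ _) (fun u : 'rV[R]_n => u 0 j)).
    exact: cvg_fst.
  exact: coord_continuous.
have c2 j : continuous (fun w : Cspace R n => w.2 0 j).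
  move=> w; apply: (@continuous_comp _ _ _ (@snd _ _) (fun u : 'rV[R]_n => u 0 j)).
    exact: cvg_snd.
  exact: coord_continuous.
elim: e => [c|j|j|e1 [d1 d1'] e2 [d2 d2']|e1 [d1 d1'] e2 [d2 d2']] /=.
- by split; exact: cst_continuous.
- by split; [exact: c1|exact: c2].
- by split; [exact: c1|move=> w; apply: cvgN; exact: c2].
- split.
  + have -> : (fun w => complex.Re (ceval e1 w + ceval e2 w)) =
      (fun w => complex.Re (ceval e1 w) + complex.Re (ceval e2 w)).
      by apply/funext => w; rewrite raddfD.
    by move=> w; apply: cvgD; [exact: d1|exact: d2].
  + have -> : (fun w => complex.Im (ceval e1 w + ceval e2 w)) =
      (fun w => complex.Im (ceval e1 w) + complex.Im (ceval e2 w)).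
      by apply/funext => w; rewrite raddfD.
    by move=> w; apply: cvgD; [exact: d1'|exact: d2'].
- split.
  + have -> : (fun w => complex.Re (ceval e1 w * ceval e2 w)) =
      (fun w => complex.Re (ceval e1 w) * complex.Re (ceval e2 w) -
                complex.Im (ceval e1 w) * complex.Im (ceval e2 w)).
      by apply/funext => w; rewrite /= ReM.
    by move=> w; apply: cvgB; apply: cvgM; [exact: d1|exact: d2|exact: d1'|exact: d2'].
  + have -> : (fun w => complex.Im (ceval e1 w * ceval e2 w)) =
      (fun w => complex.Re (ceval e1 w) * complex.Im (ceval e2 w) +
                complex.Im (ceval e1 w) * complex.Re (ceval e2 w)).
      by apply/funext => w; rewrite /= ImM.
    by move=> w; apply: cvgD; apply: cvgM; [exact: d1|exact: d2'|exact: d1'|exact: d2].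
Qed.

Lemma Ck_ceval k e : Ck k setT (fun w => complex.Re (ceval e w)) /\
  Ck k setT (fun w => complex.Im (ceval e w)).
Proof.
elim: k e => [|k IH] e; have [c1 c2] := continuous_ceval e.
  by split; split=> //.
split; split=> [x _|v]; [exact: c1| |exact: c2|];
  have [r1 r2] := IH (cdir v e); split.
- by move=> x _; have [[]] := is_derive_ceval e v x.
- have -> : (fun z => 'D_v (fun w => complex.Re (ceval e w)) z) =
      (fun w => complex.Re (ceval (cdir v e) w)) => //.
  by apply/funext => z; have [d1 _] := is_derive_ceval e v z; rewrite derive_val.
- by move=> x _; have [_ []] := is_derive_ceval e v x.
- have -> : (fun z => 'D_v (fun w => complex.Im (ceval e w)) z) =
      (fun w => complex.Im (ceval (cdir v e) w)) => //.
  by apply/funext => z; have [_ d1] := is_derive_ceval e v z; rewrite derive_val.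
Qed.

Lemma smooth_ceval V e : smooth V (fun w => complex.Re (ceval e w)) /\
  smooth V (fun w => complex.Im (ceval e w)).
Proof. by split=> k; apply: sub_Ck; have [] := Ck_ceval k e. Qed.

Fixpoint cbar (e : cpoly) : cpoly :=
  match e with
  | PCst c => PCst (Num.conj c)
  | PVar j => PBar j
  | PBar j => PVar j
  | PAdd e1 e2 => PAdd (cbar e1) (cbar e2)
  | PMul e1 e2 => PMul (cbar e1) (cbar e2)
  end.

Lemma ceval_cbar e z : ceval (cbar e) z = Num.conj (ceval e z).
Proof.
elim: e => [c|j|j|e1 h1 e2 h2|e1 h1 e2 h2] //=; first by rewrite conjCK.
- by rewrite rmorphD /= h1 h2.
- by rewrite rmorphM /= h1 h2.
Qed.

Lemma cbar_cder u v e : cbar (cder u v e) =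
  cder (fun j => Num.conj (v j)) (fun j => Num.conj (u j)) (cbar e).
Proof.
elim: e => [c|j|j|e1 h1 e2 h2|e1 h1 e2 h2] //=; first by rewrite conjC0.
- by rewrite h1 h2.
- by rewrite h1 h2.
Qed.

Lemma cder_comm u v u' v' e z :
  ceval (cder u v (cder u' v' e)) z = ceval (cder u' v' (cder u v e)) z.
Proof.
elim: e => [c|j|j|e1 h1 e2 h2|e1 h1 e2 h2] //=; first by rewrite h1 h2.
by rewrite h1 h2; ring.
Qed.

Lemma linear_unit_sum (T : ('I_n -> R[i]) -> R[i]) (b : 'I_n -> R[i]) :
  (forall a f g, T (fun j => a * f j + g j) = a * T f + T g) ->
  \sum_k b k * T (unit_at k) = T b.
Proof.
move=> Tl.
have T0 : T (fun=> 0) = 0.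
  have e0 : (fun _ : 'I_n => -1 * 0 + 0) = (fun=> 0) :> (_ -> R[i]).
    by apply/funext => j; rewrite mulr0 addr0.
  by have := Tl (-1) (fun=> 0) (fun=> 0); rewrite e0 mulN1r addNr.
have h r : \sum_(k <- r) b k * T (unit_at k) =
    T (fun j => \sum_(k <- r) b k * unit_at k j).
  elim: r => [|k r IH].
    rewrite big_nil -[LHS]T0; congr T; apply/funext => j; by rewrite big_nil.
  rewrite big_cons IH -Tl; congr T; apply/funext => j.
  by rewrite big_cons.
rewrite h; congr T; apply/funext => j.
rewrite (bigD1 j) //= {1}/unit_at eqxx mulr1 big1 ?addr0// => k kj.
by rewrite /unit_at eq_sym (negPf kj) mulr0.
Qed.

Lemma cder_sum (a : 'I_n -> R[i]) e z :
  \sum_k a k * ceval (cdz k e) z = ceval (cder a (fun=> 0) e) z.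
Proof.
apply: (linear_unit_sum (T := fun b => ceval (cder b (fun=> 0) e) z)) => c f g.
elim: e => [d|j|j|e1 h1 e2 h2|e1 h1 e2 h2] /=; rewrite ?h1 ?h2; ring.
Qed.

(** Contracting the mixed second derivatives with vectors is the same as
    deriving along these vectors, which avoids handling the Hessian entrywise. *)
Lemma cder2_sum u v (b : 'I_n -> R[i]) e z :
  \sum_k b k * ceval (cder u v (cdzbar k e)) z =
  ceval (cder u v (cder (fun=> 0) b e)) z.
Proof.
apply: (linear_unit_sum (T := fun b => ceval (cder u v (cder (fun=> 0) b e)) z)).
move=> c f g.
have h1 e' : ceval (cder (fun=> 0) (fun j => c * f j + g j) e') z =
  c * ceval (cder (fun=> 0) f e') z + ceval (cder (fun=> 0) g e') z.
  by elim: e' => [d|j|j|e1 h1 e2 h2|e1 h1 e2 h2] /=; rewrite ?h1 ?h2; ring.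
elim: e => [d|j|j|e1 k1 e2 k2|e1 k1 e2 k2] /=; rewrite ?k1 ?k2 ?h1; ring.
Qed.

End PolynomialFunctions.
Arguments cpoly : clear implicits.

Section RealPolynomial.
Context {R : realType} {n : nat}.
Variables (f : Cspace R n -> R) (e : cpoly R n).
Hypothesis fe : forall z, (f z)%:C = ceval e z.

Let fE : (fun z => (f z)%:C) = ceval e.
Proof. exact/funext. Qed.

Lemma smooth_real_poly : smooth setT f.
Proof.
have -> : f = (fun z => complex.Re (ceval e z)).
  by apply/funext => z; rewrite -fe.
by have [] := smooth_ceval setT e.
Qed.

Lemma d_zbar_funE k : d_zbar k (fun z => (f z)%:C) = ceval (cdzbar k e).
Proof. by apply/funext => z; rewrite fE d_zbar_ceval. Qed.

Lemma hessian_entry z j k :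
  complex_hessian f z j k = ceval (cdz j (cdzbar k e)) z.
Proof. by rewrite mxE d_zbar_funE d_z_ceval. Qed.

Lemma hessian_sesqui (u v : 'rV[R[i]]_n) z :
  (u *m complex_hessian f z *m v ^t*) 0 0 =
  ceval (cder (fun j => u 0 j) (fun=> 0)
          (cder (fun=> 0) (fun j => Num.conj (v 0 j)) e)) z.
Proof.
rewrite mxE -cder2_sum; apply: eq_bigr => k _.
rewrite !mxE mulrC -cder_sum; congr (_ * _); apply: eq_bigr => j _.
by rewrite hessian_entry.
Qed.

Lemma del_form (L : 'rV[R[i]]_n) z :
  (L *m del f z) 0 0 = ceval (cder (fun j => L 0 j) (fun=> 0) e) z.
Proof.
rewrite mxE -cder_sum; apply: eq_bigr => j _.
by rewrite mxE fE d_z_ceval.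
Qed.

(** A real function is its own conjugate, and conjugation exchanges d/dz_j
    and d/dzbar_j. *)
Lemma hessian_hermsym z : complex_hessian f z \is hermsymmx.
Proof.
apply/hermsymP/matrixP => j k; rewrite !mxE.
rewrite !d_zbar_funE !d_z_ceval.
have fc : ceval (cbar e) = ceval e.
  by apply/funext => w; rewrite ceval_cbar -fe conjE /= oppr0.
rewrite -[RHS]ceval_cbar !cbar_cder.
have u0 : (fun j : 'I_n => Num.conj (0 : R[i])) = (fun=> 0).
  by apply/funext => ?; rewrite conjC0.
have u1 i : (fun j : 'I_n => Num.conj (unit_at i j)) = unit_at i :> (_ -> R[i]).
  by apply/funext => ?; rewrite conj_unit_at.
rewrite u0 !u1; transitivity (ceval (cdz j (cdzbar k (cbar e))) z).
  rewrite -!d_z_ceval; congr (d_z j _ z).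
  by apply/funext => w; rewrite -!d_zbar_ceval fc.
exact: cder_comm.
Qed.

End RealPolynomial.

(** The squared modulus, as a real number. It is locked because otherwise the
    morphism lemmas would rewrite inside it, as it is a sum. *)
HB.lock Definition nsq (R : realType) (x : R[i]) : R :=
  complex.Re x ^+ 2 + complex.Im x ^+ 2.

Section Nsq.
Variable R : realType.
Implicit Types x y : R[i].

Lemma nsqE x : (nsq x)%:C = x * Num.conj x.
Proof. by case: x => a b; rewrite conjE nsq.unlock /=; simpc; congr (_ +i* _); ring. Qed.

Lemma nsq_ge0 x : 0 <= nsq x.
Proof. by rewrite nsq.unlock addr_ge0 ?sqr_ge0. Qed.

Lemma nsqM x y : nsq (x * y) = nsq x * nsq y.
Proof. by rewrite nsq.unlock ReM ImM; ring. Qed.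

Lemma nsq_conj x : nsq (Num.conj x) = nsq x.
Proof. by case: x => a b; rewrite conjE nsq.unlock /= sqrrN. Qed.

Lemma nsqN x : nsq (- x) = nsq x.
Proof. by case: x => a b; rewrite nsq.unlock /= !sqrrN. Qed.

Lemma nsq_real (c : R) : nsq c%:C = c ^+ 2.
Proof. by rewrite nsq.unlock /= expr0n addr0. Qed.

Lemma nsq0 : nsq (0 : R[i]) = 0.
Proof. by rewrite nsq.unlock /= expr0n addr0. Qed.

Lemma nsq_eq0 x : (nsq x == 0) = (x == 0).
Proof.
rewrite nsq.unlock paddr_eq0 ?sqr_ge0// !sqrf_eq0.
by case: x => a b; rewrite eq_complex.
Qed.

End Nsq.

(** * Smoothness of tangential rank one vectors *)

Section RankOneSection.
Context {R : realType} {n : nat}.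
Notation C := R[i].
Notation V := (Cspace R n.+1).
Variables (f : V -> R) (e : cpoly R n.+1) (KE : 'I_n.+1 -> cpoly R n.+1).
Variables (Om : set V) (p : V -> R).
Hypothesis fe : forall z, (f z)%:C = ceval e z.
Let K z : 'rV[C]_n.+1 := \row_j ceval (KE j) z.
Hypothesis Kf : forall z, K z *m del f z = 0.
Hypothesis f_neq0 : forall z, boundary Om z -> del f z != 0.
Hypothesis smooth_p : forall W, open W -> smooth W p.

Let f_ j := ceval (cdz j e).

Lemma del_entry j z : del f z j 0 = f_ j z.
Proof.
rewrite mxE; have -> : (fun w => (f w)%:C) = ceval e by apply/funext.
by rewrite d_z_ceval.
Qed.

(** The vectors f_j d/dz_k - f_k d/dz_j, for k different from j, which span the
    tangent space where f_j is nonzero; their coefficients are polynomials. *)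
Definition koszul_frame j (z : V) : 'M[C]_(n, n.+1) :=
  \matrix_(k, l) (f_ j z * (l == lift j k)%:R - f_ (lift j k) z * (l == j)%:R).

Lemma koszul_frame_mul j z (c : 'rV[C]_n) m :
  (c *m koszul_frame j z) 0 (lift j m) = f_ j z * c 0 m.
Proof.
rewrite mxE (bigD1 m) //= !mxE eqxx [lift j m == j]eq_sym (negPf (neq_lift j m)).
rewrite mulr1 mulr0 subr0 big1 ?addr0; first by rewrite mulrC.
move=> k km; rewrite mxE (inj_eq lift_inj) eq_sym (negPf km).
by rewrite [lift j m == j]eq_sym (negPf (neq_lift j m)) !mulr0 subr0 mulr0.
Qed.

Lemma koszul_is_frame j z : f_ j z != 0 -> is_frame f z (koszul_frame j z).
Proof.
move=> fj; split.
  apply/inj_row_free => c c0; apply/rowP => m; rewrite mxE.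
  apply: (mulfI fj); rewrite mulr0 -koszul_frame_mul c0 mxE//.
apply/matrixP => k l; rewrite (ord1 l) !mxE (bigD1_ord j) //=.
rewrite del_entry mxE eqxx (negPf (neq_lift j k)) mulr0 add0r mulr1.
rewrite (bigD1 k) //= mxE eqxx del_entry mulr1 [lift j k == j]eq_sym.
rewrite (negPf (neq_lift j k)) mulr0 subr0 big1.
  by rewrite addr0 mulNr mulrC addNr.
move=> m mk; rewrite mxE (inj_eq lift_inj) (negPf mk) eq_sym.
by rewrite (negPf (neq_lift j m)) !mulr0 subr0 mul0r.
Qed.

(** The component of K along d/dz_j is determined by the others because K is
    tangential. *)
Lemma koszul_frame_span j z :
  (\row_k K z 0 (lift j k)) *m koszul_frame j z = f_ j z *: K z.
Proof.
apply/rowP => l; rewrite [RHS]mxE.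
have [m ->|->] := unliftP j l; first by rewrite koszul_frame_mul mxE.
have /matrixP/(_ 0 0) := Kf z; rewrite !mxE (bigD1_ord j) //= del_entry => e0.
have h : \sum_k K z 0 (lift j k) * f_ (lift j k) z = - (K z 0 j * f_ j z).
  by rewrite (addr0_eq e0); apply: eq_bigr => k _; rewrite del_entry.
transitivity (- \sum_k K z 0 (lift j k) * f_ (lift j k) z).
  rewrite -sumrN; apply: eq_bigr => k _; rewrite !mxE eqxx mulr1.
  by rewrite (negPf (neq_lift j k)) mulr0 sub0r mulrN.
by rewrite h opprK mulrC mxE.
Qed.

Let wt j (z : V) : R := p z * (nsq (f_ j z))^-1.
Let koszul_coefs j (z : V) : 'M[C]_n :=
  \matrix_(k, l) ((wt j z)%:C *
     ceval (PMul (cbar (KE (lift j k))) (KE (lift j l))) z).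

(** On the open set where f_j is nonzero, K times f_j has polynomial
    coordinates in the Koszul frame; only the weight and 1 / |f_j|^2 have to be
    inverted. *)
Lemma rank1_real_section11 :
  real_section11 f Om (fun z => (p z)%:C *: ((K z) ^t* *m K z)).
Proof.
move=> z0 /f_neq0 fz0.
have [j fj] : exists j, f_ j z0 != 0.
  apply/existsP; apply: contraT => /existsPn h; case/eqP: fz0.
  by apply/colP => j; rewrite del_entry mxE; apply/eqP; have := h j; rewrite negbK.
pose NE := PMul (cdz j e) (cbar (cdz j e)).
have NEP z : nsq (f_ j z) = complex.Re (ceval NE z).
  by rewrite /= ceval_cbar -nsqE.
pose W := [set z : V | complex.Re (ceval NE z) != 0].
have WP z : W z -> f_ j z != 0 by rewrite /W /= -NEP nsq_eq0.
have oW : open W.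
  apply: (@open_comp _ _ (fun z => complex.Re (ceval NE z)) [set x | x != 0]);
    last exact: open_neq.
  by move=> z _; have [+ _] := continuous_ceval NE; apply.
exists W, (koszul_frame j), (koszul_coefs j); split=> //.
- by rewrite /W /= -NEP nsq_eq0.
- move=> k l.
  pose E := PAdd (PMul (cdz j e) (PCst (l == lift j k)%:R))
    (PMul (PCst (- (l == j)%:R)) (cdz (lift j k) e)).
  have EE : (fun z => koszul_frame j z k l) = ceval E.
    by apply/funext => z; rewrite mxE /= mulNr [X in _ - X]mulrC.
  have [s1 s2] := smooth_ceval W E; split.
    by rewrite (_ : (fun z => _) = (fun z => complex.Re (ceval E z)))// -EE.
  by rewrite (_ : (fun z => _) = (fun z => complex.Im (ceval E z)))// -EE.
- move=> k l; set E := PMul (cbar (KE (lift j k))) (KE (lift j l)).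
  have sw : smooth W (wt j).
    move=> m; apply: (Ck_mul (f := p) (g := fun z => (nsq (f_ j z))^-1)) => //.
      exact: smooth_p.
    have -> : (fun z => (nsq (f_ j z))^-1) = (fun z => (complex.Re (ceval NE z))^-1).
      by apply/funext => z; rewrite NEP.
    apply: Ck_inv => //; first by move=> z; rewrite inE.
    by have [+ _] := smooth_ceval W NE; apply.
  have [s1 s2] := smooth_ceval W E; split.
  + rewrite (_ : (fun z => _) = wt j * (fun z => complex.Re (ceval E z))).
      by move=> m; apply: Ck_mul.
    by apply/funext => z; rewrite mxE -/E ReM /= mul0r subr0.
  + rewrite (_ : (fun z => _) = wt j * (fun z => complex.Im (ceval E z))).
      by move=> m; apply: Ck_mul.
    by apply/funext => z; rewrite mxE -/E ImM /= mul0r addr0.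
- move=> z Wz _; have fz := WP _ Wz.
  set c := \row_k K z 0 (lift j k).
  have bE : koszul_coefs j z = (wt j z)%:C *: (c ^t* *m c).
    by apply/matrixP => k l; rewrite !mxE big_ord1 !mxE /= ceval_cbar.
  split; first exact: koszul_is_frame.
  + apply/hermsymP; rewrite bE.
    by rewrite trmxCZ trmxCM trmxCK conjE oppr0.
  + rewrite /vector11 bE.
    have -> : (koszul_frame j z) ^t* *m ((wt j z)%:C *: (c ^t* *m c)) *m koszul_frame j z =
        (wt j z)%:C *: ((c *m koszul_frame j z) ^t* *m (c *m koszul_frame j z)).
      by rewrite -scalemxAr -scalemxAl trmxCM !mulmxA.
    rewrite koszul_frame_span trmxCZ -scalemxAl -scalemxAr !scalerA.
    congr (_ *: _); rewrite -mulrA [Num.conj _ * _]mulrC -nsqE /wt -rmorphM.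
    by rewrite -mulrA mulVf ?mulr1// nsq_eq0.
Qed.

End RankOneSection.

(** * The domain and the new metric *)

Section Example.
Variable R : realType.
Notation C := R[i].
Notation V := (Cspace R 4).

Definition i0 : 'I_4 := @Ordinal 4 0 isT.
Definition i1 : 'I_4 := @Ordinal 4 1 isT.
Definition i2 : 'I_4 := @Ordinal 4 2 isT.
Definition i3 : 'I_4 := @Ordinal 4 3 isT.

Lemma sum4 (T : nmodType) (f : 'I_4 -> T) :
  \sum_i f i = f i0 + f i1 + f i2 + f i3.
Proof.
rewrite !big_ord_recl big_ord0 addr0 !addrA.
by congr (f _ + f _ + f _ + f _); apply/val_inj.
Qed.

Lemma ord4P (P : 'I_4 -> Prop) : P i0 -> P i1 -> P i2 -> P i3 -> forall i, P i.
Proof.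
move=> h0 h1 h2 h3 [[|[|[|[|//]]]] hi].
- by have -> : Ordinal hi = i0 by exact/val_inj.
- by have -> : Ordinal hi = i1 by exact/val_inj.
- by have -> : Ordinal hi = i2 by exact/val_inj.
- by have -> : Ordinal hi = i3 by exact/val_inj.
Qed.

(** The forms dw_1, ..., dw_4 on a vector of C^4 and, on the vector of
    coordinates of a point, the coordinates w_1, ..., w_4 themselves. *)
Definition skew1 (f : 'I_4 -> C) := f i0.
Definition skew2 (f : 'I_4 -> C) := f i0 + f i1.
Definition skew3 (f : 'I_4 -> C) := f i2.
Definition skew4 (f : 'I_4 -> C) := f i3.

Definition r1 (z : V) := nsq (skew1 (zcoord z)).
Definition r2 (z : V) := nsq (skew2 (zcoord z)).
Definition r3 (z : V) := nsq (skew3 (zcoord z)).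
Definition r4 (z : V) := nsq (skew4 (zcoord z)).
Definition rs z := r1 z + r2 z + r3 z.

(** The term rs^3 bounds the domain. The positive term that it adds to the Levi
    form is of higher order at the pole than those of r2^2 and - r1^2. *)
Definition rho (z : V) : R := r4 z - 1 + r2 z ^+ 2 - r1 z ^+ 2 + rs z ^+ 3.
(** The directions w1 and w2 are orthogonal for this metric. With the weight 8,
    the contribution of s^3 along w2 and w3 is at most the eigenvalue 1 along w4;
    the much larger weight 160 shrinks its contribution along w1. *)
Definition phi (z : V) : R := 160 * r1 z + 8 * (r2 z + r3 z) + r4 z.

Definition r1E : cpoly R 4 := PMul (PVar i0) (PBar i0).
Definition r2E : cpoly R 4 := PMul (PAdd (PVar i0) (PVar i1)) (PAdd (PBar i0) (PBar i1)).
Definition r3E : cpoly R 4 := PMul (PVar i2) (PBar i2).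
Definition r4E : cpoly R 4 := PMul (PVar i3) (PBar i3).
Definition rsE := PAdd (PAdd r1E r2E) r3E.
Definition rhoE := PAdd (PAdd (PAdd (PAdd r4E (PCst (-1))) (PMul r2E r2E))
  (PMul (PCst (-1)) (PMul r1E r1E))) (PMul rsE (PMul rsE rsE)).
Definition phiE := PAdd (PAdd (PMul (PCst 160) r1E) (PMul (PCst 8) (PAdd r2E r3E))) r4E.

Lemma r1EP z : (r1 z)%:C = ceval r1E z. Proof. by rewrite nsqE. Qed.
Lemma r2EP z : (r2 z)%:C = ceval r2E z. Proof. by rewrite nsqE rmorphD. Qed.
Lemma r3EP z : (r3 z)%:C = ceval r3E z. Proof. by rewrite nsqE. Qed.
Lemma r4EP z : (r4 z)%:C = ceval r4E z. Proof. by rewrite nsqE. Qed.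
Lemma rhoEP z : (rho z)%:C = ceval rhoE z.
Proof.
rewrite /rho !(rmorphD, rmorphN, rmorphXn, rmorph1) /=.
by rewrite r1EP r2EP r3EP r4EP /=; ring.
Qed.
Lemma phiEP z : (phi z)%:C = ceval phiE z.
Proof.
rewrite /phi !(rmorph_nat, rmorphD, rmorphM) /=.
by rewrite r1EP r2EP r3EP r4EP.
Qed.

Lemma phi_form z (L : 'rV[C]_4) :
  (L *m complex_hessian phi z *m L ^t*) 0 0 =
  (160 * nsq (skew1 (L 0)) + 8 * (nsq (skew2 (L 0)) + nsq (skew3 (L 0))) +
   nsq (skew4 (L 0)))%:C.
Proof.
rewrite (hessian_sesqui phiEP) !(rmorph_nat, rmorphD, rmorphM) /= !nsqE.
rewrite /skew1 /skew2 /skew3 /skew4 !rmorphD /=; ring.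
Qed.

Definition levi_form z (x1 x2 x3 x4 : C) : R :=
  nsq x4 + 4 * r2 z * nsq x2 - 4 * r1 z * nsq x1 +
  3 * rs z ^+ 2 * (nsq x1 + nsq x2 + nsq x3) +
  6 * rs z * nsq (Num.conj (skew1 (zcoord z)) * x1 +
    Num.conj (skew2 (zcoord z)) * x2 + Num.conj (skew3 (zcoord z)) * x3).

(** The Levi form of r_j^2 is 4 r_j |dw_j|^2, and that of s^3 is 3 s^2 times
    the sum of the |dw_j|^2 plus 6 s times |d' s|^2. *)
Lemma rho_sesqui z (u v : 'rV[C]_4) :
  let w1 := skew1 (zcoord z) in let w2 := skew2 (zcoord z) in
  let w3 := skew3 (zcoord z) in
  let x1 := skew1 (u 0) in let x2 := skew2 (u 0) in let x3 := skew3 (u 0) in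
  let y1 := skew1 (v 0) in let y2 := skew2 (v 0) in let y3 := skew3 (v 0) in
  (u *m complex_hessian rho z *m v ^t*) 0 0 =
  skew4 (u 0) * Num.conj (skew4 (v 0)) +
  (4 * r2 z)%:C * (x2 * Num.conj y2) - (4 * r1 z)%:C * (x1 * Num.conj y1) +
  (3 * rs z ^+ 2)%:C *
    (x1 * Num.conj y1 + x2 * Num.conj y2 + x3 * Num.conj y3) +
  (6 * rs z)%:C *
    ((Num.conj w1 * x1 + Num.conj w2 * x2 + Num.conj w3 * x3) *
     (w1 * Num.conj y1 + w2 * Num.conj y2 + w3 * Num.conj y3)).
Proof.
rewrite /= (hessian_sesqui rhoEP).
rewrite !(rmorph_nat, rmorphD, rmorphM, rmorphN, rmorphXn) /= r1EP r2EP r3EP /=.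
rewrite /skew1 /skew2 /skew3 /skew4.
move: (zcoord z i0 + _) (Num.conj (zcoord z i0) + _) => a a'.
move: (u 0 i0 + _) (Num.conj (v 0 i0) + _) => b b'.
by ring.
Qed.

Lemma rho_form z (L : 'rV[C]_4) :
  (L *m complex_hessian rho z *m L ^t*) 0 0 =
  (levi_form z (skew1 (L 0)) (skew2 (L 0)) (skew3 (L 0)) (skew4 (L 0)))%:C.
Proof.
rewrite rho_sesqui /levi_form /=.
move: (r1 z) (r2 z) (rs z) => a b s.
move: (skew1 (zcoord z)) (skew2 (zcoord z)) (skew3 (zcoord z)) => w1 w2 w3.
move: (skew1 (L 0)) (skew2 (L 0)) (skew3 (L 0)) (skew4 (L 0)) => x1 x2 x3 x4.
rewrite !(rmorph_nat, rmorphD, rmorphM, rmorphN, rmorphXn) /= !nsqE.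
by rewrite !(rmorphD, rmorphM) /= !conjCK; ring.
Qed.

Lemma rho_del z (L : 'rV[C]_4) :
  (L *m del rho z) 0 0 =
  Num.conj (skew4 (zcoord z)) * skew4 (L 0) +
  (2 * r2 z)%:C * Num.conj (skew2 (zcoord z)) * skew2 (L 0) -
  (2 * r1 z)%:C * Num.conj (skew1 (zcoord z)) * skew1 (L 0) +
  (3 * rs z ^+ 2)%:C * (Num.conj (skew1 (zcoord z)) * skew1 (L 0) +
    Num.conj (skew2 (zcoord z)) * skew2 (L 0) +
    Num.conj (skew3 (zcoord z)) * skew3 (L 0)).
Proof.
rewrite (del_form rhoEP).
rewrite !(rmorph_nat, rmorphD, rmorphM, rmorphN, rmorphXn) /= r1EP r2EP r3EP /=.
rewrite /skew1 /skew2 /skew3 /skew4 ?rmorphD /=.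
by ring.
Qed.

End Example.

(** With x = r4 and q = r2^2 - r1^2, this says that rho < 0 at sqrt(t) z if
    rho <= 0 at z. The left side is at most 1 - (1 - t) (1 + t q + t (1 + t) s^3),
    and the last factor is positive because s^2 - s^3 < 1. *)
Lemma interior_scaling (R : realFieldType) (s q x t : R) : 0 <= s -> 0 <= t -> t < 1 ->
  - s ^+ 2 <= q -> x + q + s ^+ 3 <= 1 ->
  t * x + t ^+ 2 * q + t ^+ 3 * s ^+ 3 < 1.
Proof.
move=> s0 t0 t1 qs h.
have g : 0 < 1 + t * q + t * (1 + t) * s ^+ 3.
  have : s ^+ 2 - s ^+ 3 < 1.
    have [s1|s1] := leP s 1.
      have : s ^+ 2 * (1 - s) <= s ^+ 2 * 1 by rewrite ler_wpM2l ?sqr_ge0//; lra.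
      by have [s12|s12] := leP s (1 / 2); nra.
    nra.
  have s3 : 0 <= s ^+ 3 by rewrite exprn_ge0.
  have := ler_wpM2l t0 qs; nra.
have : 0 < (1 - t) * (1 + t * q + t * (1 + t) * s ^+ 3) by rewrite mulr_gt0// subr_gt0.
have := ler_wpM2l t0 h; nra.
Qed.

(** On the closed domain s^3 <= 1 + r1^2 <= 1 + s^2. *)
Lemma slice_bound (R : realFieldType) (s x q a : R) : 0 <= s -> 0 <= x -> 0 <= q ->
  0 <= a <= s -> x - 1 + q - a ^+ 2 + s ^+ 3 <= 0 -> s <= 3 / 2.
Proof.
move=> s0 x0 q0 /andP[a0 as_] h; rewrite leNgt; apply/negP => s1.
have a2 : a ^+ 2 <= s ^+ 2 by rewrite ler_pXn2r.
have : 9 / 4 < s ^+ 2 by nra.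
have e : s ^+ 3 = s ^+ 2 * s by rewrite exprSr.
have : 1 < s - 1 / 2 by lra.
move=> ? ?; have : 9 / 4 * (s - 1) <= s ^+ 2 * (s - 1) by nra.
lra.
Qed.

Section Domain.
Variable R : realType.
Notation C := R[i].
Notation V := (Cspace R 4).
Implicit Types z : V.

Lemma r1_ge0 z : 0 <= r1 z. Proof. exact: nsq_ge0. Qed.
Lemma r2_ge0 z : 0 <= r2 z. Proof. exact: nsq_ge0. Qed.
Lemma r3_ge0 z : 0 <= r3 z. Proof. exact: nsq_ge0. Qed.
Lemma r4_ge0 z : 0 <= r4 z. Proof. exact: nsq_ge0. Qed.
Lemma rs_ge0 z : 0 <= rs z.
Proof. by rewrite !addr_ge0 ?r1_ge0 ?r2_ge0 ?r3_ge0. Qed.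
Lemma r1_le_rs z : r1 z <= rs z.
Proof. by rewrite /rs; move: (r2_ge0 z) (r3_ge0 z); lra. Qed.
Lemma r2_le_rs z : r2 z <= rs z.
Proof. by rewrite /rs; move: (r1_ge0 z) (r3_ge0 z); lra. Qed.

Lemma zcoordZ (t : R) z j : zcoord (t *: z) j = t%:C * zcoord z j.
Proof. by rewrite /zcoord /= !mxE; simpc. Qed.

Lemma rho_scale (t : R) z : rho (t *: z) = t ^+ 2 * r4 z - 1 +
  (t ^+ 2) ^+ 2 * (r2 z ^+ 2 - r1 z ^+ 2) + (t ^+ 2) ^+ 3 * rs z ^+ 3.
Proof.
rewrite /rho /rs /r1 /r2 /r3 /r4 /skew1 /skew2 /skew3 /skew4 !zcoordZ -!mulrDr.
by rewrite !nsqM !nsq_real; ring.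
Qed.

Lemma rho_shrink (t : R) z : 0 <= t -> t < 1 -> rho z <= 0 -> rho (t *: z) < 0.
Proof.
move=> t0 t1 h; rewrite rho_scale.
have := @interior_scaling R (rs z) (r2 z ^+ 2 - r1 z ^+ 2) (r4 z) (t ^+ 2).
rewrite rs_ge0 sqr_ge0 expr_lt1// t1; move=> /(_ isT isT isT).
have : r1 z ^+ 2 <= rs z ^+ 2 by rewrite ler_pXn2r ?nnegrE ?rs_ge0 ?r1_ge0 ?r1_le_rs.
move: h; rewrite /rho; move: (sqr_ge0 (r2 z)) => ? ? ? k.
have := k _ _; lra.
Qed.

Lemma rs_bound z : rho z <= 0 -> rs z <= 3 / 2.
Proof.
apply: slice_bound; rewrite ?rs_ge0 ?r4_ge0 ?sqr_ge0 ?r1_ge0 ?r1_le_rs//.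
Qed.

Lemma smooth_rho : smooth setT (@rho R).
Proof. exact: (smooth_real_poly (@rhoEP R)). Qed.

Lemma smooth_phi : smooth setT (@phi R).
Proof. exact: (smooth_real_poly (@phiEP R)). Qed.

Lemma continuous_rho : continuous (@rho R).
Proof. by move=> z; have [+ _] := smooth_rho 0; apply; rewrite inE. Qed.

Definition Omega : set V := [set z | rho z < 0].

Lemma open_Omega : open Omega.
Proof.
apply: (@open_comp _ _ (@rho R) [set x | x < 0]); last exact: open_lt.
by move=> z _; exact: continuous_rho.
Qed.

Lemma scale_continuous z : continuous (fun t : R => t *: z).
Proof. by move=> t; apply: scalel_continuous. Qed.

Lemma connected_Omega : connected Omega.
Proof.
pose A z := (fun t : R => t *: z) @` `[0, 1].
have -> : Omega = \bigcup_(z in Omega) A z.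
  apply/seteqP; split=> [z Oz|z [w Ow [t /= /[!in_itv]/= /andP[t0 t1] <-]]].
    by exists z => //; exists 1; rewrite ?scale1r//= in_itv/= ler01 lexx.
  have [t1'|t1'] := eqVneq t 1; first by rewrite t1' scale1r.
  apply: rho_shrink => //; last exact: ltW.
  by rewrite lt_neqAle t1'.
apply: bigcup_connected.
  exists 0 => z _; exists 0; rewrite ?scale0r//= in_itv/= ler01 lexx//.
move=> z _; apply: connected_continuous_connected.
  exact: segment_connected.
apply: continuous_subspaceT; exact: scale_continuous.
Qed.

(** Omega is open, and a zero z of rho is the limit of the points t z, with
    t < 1, at which rho < 0. *)
Lemma boundaryP z : boundary Omega z <-> rho z = 0.
Proof.
have -> : boundary Omega = closure Omega `\` Omega.
  by rewrite /boundary; have /interior_id -> := open_Omega.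
split=> [[clz nz]|z0].
  apply/eqP; rewrite eq_le; apply/andP; split; last by rewrite leNgt; apply/negP.
  have : closed [set w : V | rho w <= 0].
    apply: (@closed_comp _ _ (@rho R) [set x | x <= 0]); last exact: closed_le.
    by move=> w _; exact: continuous_rho.
  rewrite closure_id => e.
  suff : closure [set w : V | rho w <= 0] z by rewrite -e.
  by apply: closureS clz => w /ltW.
split; last by rewrite /Omega /= z0 ltxx.
move=> B zB.
have cB : \forall t \near (1 : R), B (t *: z).
  by have := @scale_continuous z 1; rewrite /continuous_at scale1r => /(_ B zB).
near (1 : R)^'- => t; exists (t *: z); split.
  apply: rho_shrink; [by near: t; exact: nbhs_left_ge| |by rewrite z0].
  by near: t; exact: nbhs_left_lt.
near: t; exact: cvg_at_left_filter cB.
Unshelve. all: by end_near. Qed.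

End Domain.

(** Half the derivative of rho along the ray through a boundary point equals
    1 + q + 2 s^3, which is positive since q >= - s^2. *)
Lemma radial_pos (R : realFieldType) (s q x : R) : 0 <= s -> - s ^+ 2 <= q ->
  x - 1 + q + s ^+ 3 = 0 -> 0 < x + 2 * q + 3 * s ^+ 3.
Proof.
move=> s0 qs h.
have e : s ^+ 3 = s ^+ 2 * s by rewrite exprSr.
have : 0 < 1 - s ^+ 2 + 2 * (s ^+ 2 * s).
  have [s1|s1] := leP s (1 / 2).
    have : s ^+ 2 <= 1 / 4 by nra.
    have : 0 <= s ^+ 2 * s by rewrite mulr_ge0 ?sqr_ge0.
    lra.
  have : 0 <= s ^+ 2 * (2 * s - 1) by rewrite mulr_ge0 ?sqr_ge0//; lra.
  lra.
lra.
Qed.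

Section DomainGeometry.
Variable R : realType.
Notation C := R[i].
Notation V := (Cspace R 4).
Implicit Types z : V.

Lemma q_ge z : - rs z ^+ 2 <= r2 z ^+ 2 - r1 z ^+ 2.
Proof.
have : r1 z ^+ 2 <= rs z ^+ 2 by rewrite ler_pXn2r ?nnegrE ?rs_ge0 ?r1_ge0 ?r1_le_rs.
have := sqr_ge0 (r2 z); lra.
Qed.

Lemma radial_derivative_pos z : rho z = 0 ->
  0 < r4 z + 2 * (r2 z ^+ 2 - r1 z ^+ 2) + 3 * rs z ^+ 3.
Proof.
move=> h; apply: radial_pos; rewrite ?rs_ge0 ?q_ge//.
by rewrite -h /rho; ring.
Qed.

(** On the radial vector, del rho takes half the radial derivative of rho. *)
Lemma del_rho_neq0 z : rho z = 0 -> del (@rho R) z != 0.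
Proof.
move=> /radial_derivative_pos h; apply/eqP => d0.
have := rho_del z (\row_j zcoord z j); rewrite d0 mulmx0 mxE.
rewrite /skew1 /skew2 /skew3 /skew4 !mxE => e; move: h.
suff -> : r4 z + 2 * (r2 z ^+ 2 - r1 z ^+ 2) + 3 * rs z ^+ 3 = 0 by rewrite ltxx.
apply: (@complexI R); rewrite rmorph0 e.
rewrite !(rmorph_nat, rmorphD, rmorphM, rmorphN, rmorphXn) /=.
rewrite !(r1EP, r2EP, r3EP, r4EP) /= /r1 /r2 /r3 /r4.
ring.
Qed.

Lemma rho_radial_derive z : rho z = 0 -> 'D_z (@rho R) z != 0.
Proof.
move=> /radial_derivative_pos h.
have -> : @rho R = (fun w => complex.Re (ceval (@rhoE R) w)).
  by apply/funext => w; rewrite -rhoEP.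
have [d _] := is_derive_ceval (@rhoE R) z z; rewrite derive_val.
rewrite [ceval _ _](_ : _ =
  (2 * (r4 z + 2 * (r2 z ^+ 2 - r1 z ^+ 2) + 3 * rs z ^+ 3))%:C) /=.
  by rewrite mulf_neq0 ?pnatr_eq0 ?gt_eqF.
rewrite !(rmorph_nat, rmorphD, rmorphM, rmorphN, rmorphXn) /=.
rewrite !(r1EP, r2EP, r3EP, r4EP) /=.
ring.
Qed.

Lemma norm_le_coords (M : R) z : 0 <= M ->
  (forall j, nsq (zcoord z j) <= M ^+ 2) -> `|z.1| <= M /\ `|z.2| <= M.
Proof.
move=> M0 h; split; rewrite /Num.norm /= mx_normrE; apply/bigmax_leP; split=> //.
- move=> [i j] _ /=; rewrite (ord1 i) -(ler_pXn2r (n := 2))// real_normK ?num_real//.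
  by apply: le_trans (h j); rewrite nsq.unlock /zcoord /= lerDl sqr_ge0.
- move=> [i j] _ /=; rewrite (ord1 i) -(ler_pXn2r (n := 2))// real_normK ?num_real//.
  by apply: le_trans (h j); rewrite nsq.unlock /zcoord /= lerDr sqr_ge0.
Qed.

Lemma nsqB_le (x y : C) : nsq (y - x) <= 2 * (nsq x + nsq y).
Proof.
case: x y => [a b] [c d]; rewrite nsq.unlock /=.
by have := sqr_ge0 (a + c); have := sqr_ge0 (b + d); nra.
Qed.

(** As z2 = w2 - w1, the coordinates z_j are bounded with the w_j. *)
Lemma coords_le (B : R) z : 0 <= B -> r1 z <= B -> r2 z <= B -> r3 z <= B ->
  r4 z <= B -> forall j, nsq (zcoord z j) <= 4 * B.
Proof.
move=> B0 h1 h2 h3 h4; apply: ord4P.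
- by move: h1; rewrite /r1 /skew1; lra.
- have -> : zcoord z i1 = skew2 (zcoord z) - skew1 (zcoord z).
    by rewrite /skew2 /skew1 addrC addKr.
  by apply: (le_trans (nsqB_le _ _)); move: h1 h2; rewrite /r1 /r2; lra.
- by move: h3; rewrite /r3 /skew3; lra.
- by move: h4; rewrite /r4 /skew4; lra.
Qed.

Lemma bounded_Omega : bounded_set (@Omega R).
Proof.
rewrite /bounded_near /mkset; near=> M; move=> z Oz /=; apply: (@le_trans _ _ 4); last first.
  by near: M; exact: nbhs_pinfty_ge.
have h := ltW Oz; have sb := rs_bound h.
have [|n1 n2] := @norm_le_coords 4 z (ler0n _ _); last first.
  by rewrite /Num.norm /= ge_max n1 n2.
move=> j; have : nsq (zcoord z j) <= 4 * (13 / 4).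
  apply: coords_le; first lra.
  - by have := r1_le_rs z; lra.
  - by have := r2_le_rs z; lra.
  - by have := r1_ge0 z; have := r2_ge0 z; move: sb; rewrite /rs; lra.
  - have s3 : 0 <= rs z ^+ 3 by rewrite exprn_ge0 ?rs_ge0.
    have := q_ge z; have : rs z ^+ 2 <= (3 / 2) ^+ 2.
      by rewrite ler_pXn2r ?nnegrE ?rs_ge0//; lra.
    by move: h; rewrite /rho; lra.
lra.
Unshelve. all: by end_near. Qed.

Lemma bounded_domain_Omega : bounded_domain (@Omega R).
Proof.
split.
- exists 0; rewrite /Omega /=.
  have := @rho_scale R 0 0; rewrite scale0r => ->.
  by rewrite [X in X < 0](_ : _ = - 1) ?ltrN10//; ring.
- exact: open_Omega.
- exact: connected_Omega.
- exact: bounded_Omega.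
Qed.

Lemma defining_rho : smooth_defining_function (@rho R) (@Omega R).
Proof.
split=> //; first exact: smooth_rho.
by move=> z /boundaryP z0; exists z; exact: rho_radial_derive.
Qed.

Lemma compact_box (M : R) :
  compact ([set x : 'rV[R]_4 | `|x| <= M] `*` [set x : 'rV[R]_4 | `|x| <= M]).
Proof.
have cb : compact [set x : 'rV[R]_4 | `|x| <= M].
  apply: bounded_closed_compact.
    rewrite /bounded_near /mkset; near=> N; move=> x /= xM; apply: (le_trans xM).
    by near: N; apply: nbhs_pinfty_ge; exact: num_real.
  apply: (@closed_comp _ _ (fun x : 'rV[R]_4 => `|x|) [set x | x <= M]).
    by move=> w _; exact: norm_continuous.
  exact: closed_le.
exact: compact_setX.
Unshelve. all: by end_near. Qed.

Lemma exhaustion_phi : exhaustion (@phi R).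
Proof.
move=> c; pose B := `|c| + 1; pose M := 2 * B.
have B1 : 1 <= B by rewrite /B lerDr.
apply: (@precompact_subset _ _
  ([set x : 'rV[R]_4 | `|x| <= M] `*` [set x : 'rV[R]_4 | `|x| <= M])).
  move=> z /= hz; apply/andP.
  have cB : c <= B by rewrite /B; have := ler_norm c; lra.
  have [||n1 n2] := @norm_le_coords M z; first by rewrite /M; lra.
    move=> j; apply: (@le_trans _ _ (4 * B)); last by rewrite /M; nra.
    move: (r1_ge0 z) (r2_ge0 z) (r3_ge0 z) (r4_ge0 z) hz; rewrite /phi.
    by move=> *; apply: coords_le; lra.
  by rewrite n1 n2.
apply: compact_precompact; last exact: compact_box.
exact: norm_hausdorff.
Qed.

Lemma phi_pos z (L : 'rV[C]_4) : L != 0 ->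
  0 < (L *m complex_hessian (@phi R) z *m L ^t*) 0 0.
Proof.
move=> L0; rewrite phi_form ltcR lt_neqAle eq_sym.
have h0 := nsq_ge0 (skew1 (L 0)); have h1 := nsq_ge0 (skew2 (L 0)).
have h2 := nsq_ge0 (skew3 (L 0)); have h3 := nsq_ge0 (skew4 (L 0)).
apply/andP; split; last by lra.
apply: contra L0 => /eqP e.
have : skew1 (L 0) = 0 by apply/eqP; rewrite -nsq_eq0; apply/eqP; lra.
have : skew2 (L 0) = 0 by apply/eqP; rewrite -nsq_eq0; apply/eqP; lra.
have : skew3 (L 0) = 0 by apply/eqP; rewrite -nsq_eq0; apply/eqP; lra.
have : skew4 (L 0) = 0 by apply/eqP; rewrite -nsq_eq0; apply/eqP; lra.
rewrite /skew1 /skew2 /skew3 /skew4 => k3 k2 + k0; rewrite k0 add0r => k1.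
by apply/eqP/rowP; apply: ord4P; rewrite mxE.
Qed.

Lemma spsh_phi : strictly_plurisubharmonic (@phi R).
Proof. by split; [exact: smooth_phi|move=> z L; exact: phi_pos]. Qed.

End DomainGeometry.

(** * Weak Z(2) for the new metric *)

Section RealInequalities.
Variable R : realFieldType.
Implicit Types s a b x A B : R.

(** In this part a stands for r1, b for r2, x for r4. The quantity bounded is
    the square of |d rho / dw1|. *)
Lemma slope_bound s a : 0 <= a <= s -> s <= 3 / 2 ->
  (3 * s ^+ 2 - 2 * a) ^+ 2 * a <= s ^+ 2 * (9 * s ^+ 2 * s + 4 * s).
Proof.
move=> /andP[a0 as_] s32; have s0 : 0 <= s by lra.
have h2 : (3 * s ^+ 2 - 2 * a) ^+ 2 <= 9 * s ^+ 4 + 4 * s ^+ 2.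
  have e : (3 * s ^+ 2 - 2 * a) ^+ 2 = 9 * s ^+ 4 - 12 * (s ^+ 2 * a) + 4 * a ^+ 2 by ring.
  have : 0 <= s ^+ 2 * a by rewrite mulr_ge0 ?sqr_ge0.
  have : a ^+ 2 <= s ^+ 2 by rewrite ler_pXn2r.
  lra.
have := ler_pM (sqr_ge0 _) a0 h2 as_.
by congr (_ <= _); ring.
Qed.

Lemma cube_bound s : 0 <= s -> s <= 3 / 2 -> 9 * s ^+ 2 * s + 4 * s <= 37.
Proof.
move=> s0 s32; have s2 : s ^+ 2 <= 9 / 4 by nra.
have : s ^+ 2 * s <= 9 / 4 * s by rewrite ler_wpM2r.
rewrite -mulrA; nra.
Qed.

(** Condition (i) for the field of the construction: its squared length is
    160 r4 + |d rho / dw1|^2, and r4 <= 1 + r1^2 - s^3 on the boundary. *)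
Lemma field_norm_bound s a b x : 0 <= a <= s -> s <= 3 / 2 ->
  x - 1 + b ^+ 2 - a ^+ 2 + s ^+ 3 = 0 ->
  160 * x + (3 * s ^+ 2 - 2 * a) ^+ 2 * a <= 160 * (1 + a ^+ 2).
Proof.
move=> /[dup] h /andP[a0 as_] s32 e; have s0 : 0 <= s by lra.
have h1 := slope_bound h s32.
have : s ^+ 2 * (9 * s ^+ 2 * s + 4 * s) <= 160 * s ^+ 3.
  have -> : s ^+ 2 * (9 * s ^+ 2 * s + 4 * s) = s ^+ 3 * (9 * s ^+ 2 + 4) by ring.
  rewrite mulrC; apply: ler_wpM2r; first by rewrite exprn_ge0.
  nra.
have := sqr_ge0 b; lra.
Qed.

(** Condition (ii) for the field of the construction, given the lower bound
    (63 s^2 - 4 r1) / 160 for mu_1 + mu_2. The terms in r1 cancel up to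
    4 r1 (1 + r1^2 - r4), which is at most 15 s^2; with the 37 s^2 of the
    previous bounds this stays below 63 s^2 - 9 s^2. *)
Lemma field_levi_bound s a b x : 0 <= a <= s -> 0 <= b <= s -> 0 <= x -> s <= 3 / 2 ->
  x - 1 + b ^+ 2 - a ^+ 2 + s ^+ 3 = 0 ->
  (3 * s ^+ 2 - 4 * a + 6 * s * a) * x + (3 * s ^+ 2 - 2 * a) ^+ 2 * a <=
  (1 + a ^+ 2) * (63 * s ^+ 2 - 4 * a).
Proof.
move=> /[dup] h /andP[a0 as_] /andP[b0 bs] x0 s32 e; have s0 : 0 <= s by lra.
have h1 := slope_bound h s32; have h2 := cube_bound s0 s32.
have s20 : 0 <= s ^+ 2 by rewrite sqr_ge0.
have h3 : s ^+ 2 * (9 * s ^+ 2 * s + 4 * s) <= s ^+ 2 * 37 by rewrite ler_wpM2l.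
set D := b ^+ 2 + s ^+ 3.
have xE : x = 1 + a ^+ 2 - D by rewrite /D; lra.
have D0 : 0 <= D by rewrite addr_ge0 ?sqr_ge0 ?exprn_ge0.
have aD : a * D <= s ^+ 2 * (15 / 4).
  have Ds : D <= s ^+ 2 * (5 / 2).
    rewrite /D; have : b ^+ 2 <= s ^+ 2 by rewrite ler_pXn2r.
    have -> : s ^+ 3 = s ^+ 2 * s by rewrite exprSr.
    have : s ^+ 2 * s <= s ^+ 2 * (3 / 2) by rewrite ler_wpM2l.
    lra.
  apply: (le_trans (ler_pM a0 D0 (le_trans as_ s32) Ds)); lra.
have sx : (3 * s ^+ 2 + 6 * s * a) * x <= 9 * s ^+ 2 * (1 + a ^+ 2).
  have sa : s * a <= s ^+ 2 by rewrite expr2 ler_wpM2l.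
  have sa0 : 0 <= s * a by rewrite mulr_ge0.
  apply: ler_pM => //; lra.
have sB : s ^+ 2 <= s ^+ 2 * (1 + a ^+ 2).
  by rewrite ler_peMr// lerDl sqr_ge0.
have -> : (3 * s ^+ 2 - 4 * a + 6 * s * a) * x =
  (3 * s ^+ 2 + 6 * s * a) * x - 4 * (a * (1 + a ^+ 2)) + 4 * (a * D).
  by rewrite {2}xE [in LHS]xE; ring.
have -> : (1 + a ^+ 2) * (63 * s ^+ 2 - 4 * a) =
  63 * (s ^+ 2 * (1 + a ^+ 2)) - 4 * (a * (1 + a ^+ 2)) by ring.
lra.
Qed.

(** The A_j are the masses of an orthonormal pair along w_j. Relative to the
    metric, the coefficient of the form is least along w1, where the mass
    160 A1 is at most 1, and greatest along w4; so the sum is least when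
    160 A1 = 1 and A4 = 0. *)
Lemma eigen_sum_bound s a A1 A2 A3 A4 : 0 <= a -> 0 <= s -> s <= 3 / 2 ->
  0 <= A4 -> 160 * A1 <= 1 ->
  160 * A1 + 8 * (A2 + A3) + A4 = 2 ->
  (63 * s ^+ 2 - 4 * a) / 160 <=
  A4 - 4 * a * A1 + 3 * s ^+ 2 * (A1 + A2 + A3).
Proof.
move=> a0 s0 s32 A40 A11 e.
have s2 : s ^+ 2 <= 9 / 4 by nra.
have s20 : 0 <= s ^+ 2 by rewrite sqr_ge0.
have e' : A2 + A3 = (2 - 160 * A1 - A4) / 8 by lra.
rewrite -(addrA A1) e'.
have : 0 <= (1 - 160 * A1) * (4 * a + 57 * s ^+ 2) by rewrite mulr_ge0; lra.
have : 0 <= A4 * (8 - 3 * s ^+ 2) by rewrite mulr_ge0; lra.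
lra.
Qed.

End RealInequalities.

Lemma orthonormal_combination (C : numClosedFieldType) n (H : 'M[C]_n)
    (u v : 'rV[C]_n) (a b : C) : H \is hermsymmx ->
  (u *m H *m u ^t*) 0 0 = 1 -> (v *m H *m v ^t*) 0 0 = 1 ->
  (u *m H *m v ^t*) 0 0 = 0 ->
  ((a *: u + b *: v) *m H *m (a *: u + b *: v) ^t*) 0 0 =
  a * Num.conj a + b * Num.conj b.
Proof.
move=> /hermsymP hH uu vv uv.
have uuM : u *m H *m u ^t* = 1%:M by rewrite [LHS]mx11_scalar uu.
have vvM : v *m H *m v ^t* = 1%:M by rewrite [LHS]mx11_scalar vv.
have uvM : u *m H *m v ^t* = 0 by rewrite [LHS]mx11_scalar uv raddf0.
have vuM : v *m H *m u ^t* = 0.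
  transitivity ((u *m H *m v ^t*) ^t*).
    by rewrite !trmxCM trmxCK -hH mulmxA.
  by rewrite uvM trmx0 map_mx0.
have -> : (a *: u + b *: v) ^t* = Num.conj a *: u ^t* + Num.conj b *: v ^t*.
  rewrite -!trmxCZ; apply/matrixP => i j; by rewrite !mxE rmorphD.
rewrite !mulmxDl !mulmxDr -!scalemxAl -!scalemxAr uuM vvM uvM vuM.
by rewrite !scaler0 addr0 add0r !scalerA !mxE !mulr1.
Qed.

Section Positive.
Variable R : realType.
Notation C := R[i].
Notation V := (Cspace R 4).
Implicit Types z : V.

Definition hE : cpoly R 4 :=
  PAdd (PMul (PCst 3) (PMul (rsE R) (rsE R))) (PMul (PCst (-2)) (r1E R)).

(** The field (conj w4) d/dw1 - h (conj w1) d/dw4, in the coordinates z, where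
    d/dw1 = d/dz1 - d/dz2. *)
Definition wfieldE (j : 'I_4) : cpoly R 4 :=
  nth (PCst 0) [:: PBar i3; PMul (PCst (-1)) (PBar i3); PCst 0;
    PMul (PCst (-1)) (PMul hE (PBar i0))] j.

Definition wfield z : 'rV[C]_4 := \row_j ceval (wfieldE j) z.

(** In the coordinates w, the derivative d rho / dw1 is this factor times the
    conjugate of w1. *)
Definition slope z : R := 3 * rs z ^+ 2 - 2 * r1 z.

Lemma hEP z : (slope z)%:C = ceval hE z.
Proof.
rewrite /slope /= !(rmorph_nat, rmorphD, rmorphN, rmorphM, rmorphXn) /=.
by rewrite r1EP r2EP r3EP /=; ring.
Qed.

Lemma skew1_wfield z : skew1 (wfield z 0) = Num.conj (skew4 (zcoord z)).
Proof. by rewrite /skew1 mxE. Qed.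
Lemma skew2_wfield z : skew2 (wfield z 0) = 0.
Proof. by rewrite /skew2 !mxE /= mulN1r subrr. Qed.
Lemma skew3_wfield z : skew3 (wfield z 0) = 0.
Proof. by rewrite /skew3 !mxE. Qed.
Lemma skew4_wfield z :
  skew4 (wfield z 0) = - ((slope z)%:C * Num.conj (skew1 (zcoord z))).
Proof. by rewrite hEP /skew4 mxE [ceval _ _]/= mulN1r. Qed.

Lemma wfield_tangent z : wfield z *m del (@rho R) z = 0.
Proof.
apply/matrixP => i j; rewrite (ord1 i) (ord1 j) rho_del [RHS]mxE.
rewrite skew1_wfield skew2_wfield skew3_wfield skew4_wfield /slope.
rewrite !(rmorph_nat, rmorphD, rmorphN, rmorphM, rmorphXn) /=.
by ring.
Qed.

Definition weight z : R := (160 * (1 + r1 z ^+ 2))^-1.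

Lemma smooth_weight W : open W -> smooth W weight.
Proof.
move=> oW k; pose E := PMul (PCst 160) (PAdd (PCst 1) (PMul (r1E R) (r1E R))).
have EP z : complex.Re (ceval E z) = 160 * (1 + r1 z ^+ 2).
  suff <- : (160 * (1 + r1 z ^+ 2))%:C = ceval E z by [].
  rewrite !(rmorph_nat, rmorph1, rmorphD, rmorphM, rmorphXn) /=.
  by rewrite r1EP.
have -> : weight = (fun z => (complex.Re (ceval E z))^-1).
  by apply/funext => z; rewrite EP.
apply: Ck_inv => //; last by have [+ _] := smooth_ceval W E; apply.
move=> z _; rewrite EP mulf_neq0 ?pnatr_eq0// gt_eqF//.
by have := sqr_ge0 (r1 z); lra.
Qed.

Definition rank1_vector z : 'M[C]_4 := (weight z)%:C *: ((wfield z) ^t* *m wfield z).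

Lemma rank1_vector_section : real_section11 (@rho R) (@Omega R) rank1_vector.
Proof.
apply: (rank1_real_section11 (@rhoEP R)).
- exact: wfield_tangent.
- by move=> z /boundaryP; exact: del_rho_neq0.
- exact: smooth_weight.
Qed.

Lemma wfield_phi z : (wfield z *m complex_hessian (@phi R) z *m (wfield z) ^t*) 0 0 =
  (160 * r4 z + slope z ^+ 2 * r1 z)%:C.
Proof.
rewrite phi_form skew1_wfield skew2_wfield skew3_wfield skew4_wfield.
by rewrite nsqN nsqM nsq_real !nsq_conj nsq0 addr0 mulr0 addr0.
Qed.

Lemma wfield_rho z : (wfield z *m complex_hessian (@rho R) z *m (wfield z) ^t*) 0 0 =
  ((3 * rs z ^+ 2 - 4 * r1 z + 6 * rs z * r1 z) * r4 z + slope z ^+ 2 * r1 z)%:C.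
Proof.
rewrite rho_form /levi_form skew1_wfield skew2_wfield skew3_wfield skew4_wfield.
rewrite !mulr0 !addr0 nsqN !nsqM nsq_real !nsq_conj nsq0 /r1 /r4.
by congr (_%:C); ring.
Qed.

Lemma levi_form_ge z (x1 x2 x3 x4 : C) :
  nsq x4 - 4 * r1 z * nsq x1 + 3 * rs z ^+ 2 * (nsq x1 + nsq x2 + nsq x3) <=
  levi_form z x1 x2 x3 x4.
Proof.
rewrite /levi_form.
have : 0 <= 4 * r2 z * nsq x2 by rewrite !mulr_ge0 ?r2_ge0 ?nsq_ge0.
set y := _ + _ * x3; have : 0 <= 6 * rs z * nsq y by rewrite !mulr_ge0 ?rs_ge0 ?nsq_ge0.
lra.
Qed.

(** Bessel's inequality for the covector dw1, whose squared dual norm is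
    1 / 160. *)
Lemma bessel_skew1 z (u v : 'rV[C]_4) :
  (u *m complex_hessian (@phi R) z *m u ^t*) 0 0 = 1 ->
  (v *m complex_hessian (@phi R) z *m v ^t*) 0 0 = 1 ->
  (u *m complex_hessian (@phi R) z *m v ^t*) 0 0 = 0 ->
  160 * (nsq (skew1 (u 0)) + nsq (skew1 (v 0))) <= 1.
Proof.
set H := complex_hessian _ _ => uu vv uv.
set a := skew1 (u 0); set b := skew1 (v 0).
(* the projection to span(u, v) of the vector dual to the first coordinate,
   whose squared length is t and whose first coordinate is t too *)
pose y := Num.conj a *: u + Num.conj b *: v.
set t := nsq a + nsq b.
have yy : (y *m H *m y ^t*) 0 0 = t%:C.
  have hH : H \is hermsymmx := hessian_hermsym (@phiEP R) z.
  rewrite (orthonormal_combination _ _ hH uu vv uv).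
  by rewrite !conjCK /t rmorphD /= !nsqE; ring.
have y1 : skew1 (y 0) = t%:C.
  rewrite /skew1 !mxE -/(skew1 (u 0)) -/(skew1 (v 0)) -/a -/b.
  by rewrite /t rmorphD /= !nsqE; ring.
have := yy; rewrite phi_form y1 nsq_real => /complexI e.
have t0 : 0 <= t by rewrite addr_ge0 ?nsq_ge0.
have h : 160 * t ^+ 2 <= t.
  move: (nsq_ge0 (skew2 (y 0))) (nsq_ge0 (skew3 (y 0))) (nsq_ge0 (skew4 (y 0))).
  by rewrite -{2}e; lra.
have [->|tn] := eqVneq t 0; first by rewrite mulr0.
have tp : 0 < t by rewrite lt_neqAle eq_sym tn.
by rewrite -(ler_pM2r tp) mul1r -mulrA -expr2.
Qed.

Lemma weakZ_phi : weakZ 2 (@rho R) (@Omega R) (@phi R).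
Proof.
exists rank1_vector; first exact: rank1_vector_section.
move=> z F b /boundaryP z0 [Ff Fa] Ub.
have zs : rs z <= 3 / 2 by apply: rs_bound; rewrite z0.
have a01 : 0 <= r1 z <= rs z by rewrite r1_ge0 r1_le_rs.
have b01 : 0 <= r2 z <= rs z by rewrite r2_ge0 r2_le_rs.
have e0 : r4 z - 1 + r2 z ^+ 2 - r1 z ^+ 2 + rs z ^+ 3 = 0 by rewrite -z0.
have B0 : 0 < 160 * (1 + r1 z ^+ 2).
  by have := sqr_ge0 (r1 z); lra.
apply: (rank1_weakZ Ff Fa (del_rho_neq0 z0)
  (hessian_hermsym (@rhoEP R) z) (hessian_hermsym (@phiEP R) z)
  (phi_pos z) (wfield_tangent z) (p := (weight z)%:C)) => //.
- by rewrite ler0c invr_ge0 ltW.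
- rewrite wfield_phi -rmorphM /= -(rmorph1 (real_complex R)) lecR /weight.
  by rewrite mulrC ler_pdivrMr// mul1r; exact: (field_norm_bound a01 zs e0).
- move=> u v _ _ uu vv uv; rewrite wfield_rho !rho_form -rmorphM -rmorphD lecR.
  have bs := bessel_skew1 uu vv uv.
  have := uu; rewrite phi_form -(rmorph1 (real_complex R)) => /complexI nu.
  have := vv; rewrite phi_form -(rmorph1 (real_complex R)) => /complexI nv.
  apply: (@le_trans _ _ ((63 * rs z ^+ 2 - 4 * r1 z) / 160)).
    rewrite /weight mulrC ler_pdivrMr//.
    have -> : (63 * rs z ^+ 2 - 4 * r1 z) / 160 * (160 * (1 + r1 z ^+ 2)) =
      (1 + r1 z ^+ 2) * (63 * rs z ^+ 2 - 4 * r1 z) by field.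
    exact: (field_levi_bound a01 b01 (r4_ge0 z) zs e0).
  apply: (le_trans _ (lerD (levi_form_ge _ _ _ _ _) (levi_form_ge _ _ _ _ _))).
  have := @eigen_sum_bound R (rs z) (r1 z)
    (nsq (skew1 (u 0)) + nsq (skew1 (v 0))) (nsq (skew2 (u 0)) + nsq (skew2 (v 0)))
    (nsq (skew3 (u 0)) + nsq (skew3 (v 0))) (nsq (skew4 (u 0)) + nsq (skew4 (v 0)))
    (r1_ge0 z) (rs_ge0 z) zs (addr_ge0 (nsq_ge0 _) (nsq_ge0 _)) bs.
  move=> h; apply: (le_trans (h _)); first by lra.
  lra.
Qed.

End Positive.

(** * Failure of weak Z(2) for the Euclidean metric *)

Lemma form_inj (C : numClosedFieldType) n (A B : 'M[C]_n) :
  (forall u v : 'rV[C]_n, (u *m A *m v ^t*) 0 0 = (u *m B *m v ^t*) 0 0) ->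
  A = B.
Proof.
move=> h; apply/matrixP => i j; have := h (row i 1%:M) (row j 1%:M).
by rewrite !row_form trmx1 map_mx1 !mul1mx !mulmx1.
Qed.

Lemma rank1_form (C : numClosedFieldType) n (x : 'cV[C]_n) (u v : 'rV[C]_n) :
  (u *m (x *m x ^t*) *m v ^t*) 0 0 =
  (u *m x) 0 0 * Num.conj ((v *m x) 0 0).
Proof.
have -> : u *m (x *m x ^t*) *m v ^t* = (u *m x) *m (v *m x) ^t*.
  by rewrite trmxCM !mulmxA.
by rewrite mxE big_ord1 [((v *m x) ^t*) _ _]mxE [((v *m x)^T) _ _]mxE.
Qed.

Lemma trace_rank1_form (C : numClosedFieldType) n (U : 'M[C]_n) (x : 'cV[C]_n) :
  \tr (U *m (x *m x ^t*)) = (x ^t* *m U *m x) 0 0.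
Proof. by rewrite mulmxA mxtrace_mulC mulmxA trace_mx11. Qed.

Section DiagonalForm.
Variables (C : numClosedFieldType) (n : nat) (x1 x2 x3 x4 : 'cV[C]_n).
Variables (c1 c2 c3 c4 : C).
Let D := c1 *: (x1 *m x1 ^t*) + c2 *: (x2 *m x2 ^t*) + c3 *: (x3 *m x3 ^t*) +
  c4 *: (x4 *m x4 ^t*).

Lemma diag4_form (u v : 'rV[C]_n) : (u *m D *m v ^t*) 0 0 =
  c1 * ((u *m x1) 0 0 * Num.conj ((v *m x1) 0 0)) +
  c2 * ((u *m x2) 0 0 * Num.conj ((v *m x2) 0 0)) +
  c3 * ((u *m x3) 0 0 * Num.conj ((v *m x3) 0 0)) +
  c4 * ((u *m x4) 0 0 * Num.conj ((v *m x4) 0 0)).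
Proof.
rewrite /D !mulmxDr !mulmxDl -!scalemxAr -!scalemxAl -!rank1_form.
have mxD (A B : 'M[C]_1) : (A + B) 0 0 = A 0 0 + B 0 0 by rewrite mxE.
have mxZ (c : C) (A : 'M[C]_1) : (c *: A) 0 0 = c * A 0 0 by rewrite mxE.
by rewrite !mxD !mxZ.
Qed.

Lemma diag4_trace (U : 'M[C]_n) : \tr (U *m D) =
  c1 * (x1 ^t* *m U *m x1) 0 0 + c2 * (x2 ^t* *m U *m x2) 0 0 +
  c3 * (x3 ^t* *m U *m x3) 0 0 + c4 * (x4 ^t* *m U *m x4) 0 0.
Proof.
by rewrite /D !mulmxDr -!scalemxAr !mxtraceD !mxtraceZ !trace_rank1_form.
Qed.

End DiagonalForm.

Section SkewCovectors.
Variable R : realType.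
Notation C := R[i].
Notation V := (Cspace R 4).
Implicit Types z : V.

Definition xi1 : 'cV[C]_4 := delta_mx i0 0.
Definition xi2 : 'cV[C]_4 := delta_mx i0 0 + delta_mx i1 0.
Definition xi3 : 'cV[C]_4 := delta_mx i2 0.
Definition xi4 : 'cV[C]_4 := delta_mx i3 0.

Lemma mul_xi1 (u : 'rV[C]_4) : (u *m xi1) 0 0 = skew1 (u 0).
Proof. by rewrite -colE mxE. Qed.
Lemma mul_xi2 (u : 'rV[C]_4) : (u *m xi2) 0 0 = skew2 (u 0).
Proof. by rewrite mulmxDr -!colE !mxE. Qed.
Lemma mul_xi3 (u : 'rV[C]_4) : (u *m xi3) 0 0 = skew3 (u 0).
Proof. by rewrite -colE mxE. Qed.
Lemma mul_xi4 (u : 'rV[C]_4) : (u *m xi4) 0 0 = skew4 (u 0).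
Proof. by rewrite -colE mxE. Qed.

(** The hermitian form that is the sum of the c_j |dw_j|^2. *)
Definition skew_diag (c1 c2 c3 c4 : R) : 'M[C]_4 :=
  c1%:C *: (xi1 *m xi1 ^t*) + c2%:C *: (xi2 *m xi2 ^t*) +
  c3%:C *: (xi3 *m xi3 ^t*) + c4%:C *: (xi4 *m xi4 ^t*).

Lemma skew_diag_sesqui c1 c2 c3 c4 (u v : 'rV[C]_4) :
  (u *m skew_diag c1 c2 c3 c4 *m v ^t*) 0 0 =
  c1%:C * (skew1 (u 0) * Num.conj (skew1 (v 0))) +
  c2%:C * (skew2 (u 0) * Num.conj (skew2 (v 0))) +
  c3%:C * (skew3 (u 0) * Num.conj (skew3 (v 0))) +
  c4%:C * (skew4 (u 0) * Num.conj (skew4 (v 0))).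
Proof.
by rewrite /skew_diag diag4_form !mul_xi1 !mul_xi2 !mul_xi3 !mul_xi4.
Qed.

Lemma skew_diag_form c1 c2 c3 c4 (u : 'rV[C]_4) :
  (u *m skew_diag c1 c2 c3 c4 *m u ^t*) 0 0 =
  (c1 * nsq (skew1 (u 0)) + c2 * nsq (skew2 (u 0)) + c3 * nsq (skew3 (u 0)) +
   c4 * nsq (skew4 (u 0)))%:C.
Proof.
rewrite skew_diag_sesqui.
move: (skew1 (u 0)) (skew2 (u 0)) (skew3 (u 0)) (skew4 (u 0)) => *.
by rewrite !rmorphD !rmorphM /= !nsqE.
Qed.

Lemma trace_skew_diag c1 c2 c3 c4 (U : 'M[C]_4) :
  \tr (U *m skew_diag c1 c2 c3 c4) =
  c1%:C * (xi1 ^t* *m U *m xi1) 0 0 + c2%:C * (xi2 ^t* *m U *m xi2) 0 0 +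
  c3%:C * (xi3 ^t* *m U *m xi3) 0 0 + c4%:C * (xi4 ^t* *m U *m xi4) 0 0.
Proof.
exact: diag4_trace.
Qed.

Lemma hessian_rho_axis1 z : skew2 (zcoord z) = 0 -> skew3 (zcoord z) = 0 ->
  complex_hessian (@rho R) z =
  skew_diag (9 * r1 z ^+ 2 - 4 * r1 z) (3 * r1 z ^+ 2) (3 * r1 z ^+ 2) 1.
Proof.
move=> w2 w3; apply: form_inj => u v.
rewrite rho_sesqui skew_diag_sesqui /=.
have r20 : r2 z = 0 by rewrite /r2 w2 nsq0.
have -> : rs z = r1 z by rewrite /rs r20 /r3 w3 nsq0 !addr0.
rewrite r20 w2 w3 conjC0 /r1.
move: (skew1 (zcoord z)) (skew1 (u 0)) (skew2 (u 0)) (skew3 (u 0)) (skew4 (u 0))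
  (skew1 (v 0)) (skew2 (v 0)) (skew3 (v 0)) (skew4 (v 0)) => *.
rewrite !(rmorph_nat, rmorphD, rmorphN, rmorphM, rmorphXn, rmorph0) /= !nsqE.
by ring.
Qed.

Lemma hessian_rho_axis2 z : skew1 (zcoord z) = 0 -> skew3 (zcoord z) = 0 ->
  complex_hessian (@rho R) z =
  skew_diag (3 * r2 z ^+ 2) (9 * r2 z ^+ 2 + 4 * r2 z) (3 * r2 z ^+ 2) 1.
Proof.
move=> w1 w3; apply: form_inj => u v.
rewrite rho_sesqui skew_diag_sesqui /=.
have r10 : r1 z = 0 by rewrite /r1 w1 nsq0.
have -> : rs z = r2 z by rewrite /rs r10 /r3 w3 nsq0 addr0 add0r.
rewrite r10 w1 w3 conjC0 /r2.
move: (skew2 (zcoord z)) (skew1 (u 0)) (skew2 (u 0)) (skew3 (u 0)) (skew4 (u 0))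
  (skew1 (v 0)) (skew2 (v 0)) (skew3 (v 0)) (skew4 (v 0)) => *.
rewrite !(rmorph_nat, rmorphD, rmorphN, rmorphM, rmorphXn, rmorph0) /= !nsqE.
by ring.
Qed.

End SkewCovectors.

Section RealObstruction.
Variable R : realFieldType.
Implicit Types t w g a : R.

(** The inequality of the obstruction along w2 = w3 = 0, with w1 = t, g_j the
    value of Upsilon on dw_j, and a the derivative of rho along w1. Once g4 >= 0
    is dropped, what remains besides the terms in c1 is of size t^4, while c1 is
    close to - 4 t^2. *)
Lemma axis1_bound t w g1 g2 g3 g4 : 0 < t -> t <= 1 / 2 ->
  w ^+ 2 = 1 + t ^+ 4 - t ^+ 6 ->
  g1 <= 1 -> 0 <= g2 -> 0 <= g3 -> 0 <= g4 ->
  let a := (3 * t ^+ 4 - 2 * t ^+ 2) * t in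
  let c1 := 9 * t ^+ 4 - 4 * t ^+ 2 in let c2 := 3 * t ^+ 4 in
  c2 + (c1 * g1 + c2 * g2 + c2 * g3 + g4) <=
  c1 + 2 * c2 + c2 + 1 - (c1 * a ^+ 2 + c2 * a ^+ 2 + w ^+ 2) / (a ^+ 2 + w ^+ 2) ->
  1 - 8 * t ^+ 2 <= g1.
Proof.
move=> t0 t12 wE g1le g20 g30 g40 a c1 c2 h.
have t2 : t ^+ 2 <= 1 / 4 by nra.
have t20 : 0 < t ^+ 2 by rewrite exprn_gt0.
have t4E : t ^+ 4 = t ^+ 2 * t ^+ 2 by ring.
have t6E : t ^+ 6 = t ^+ 2 * t ^+ 2 * t ^+ 2 by ring.
set x := t ^+ 2 in t2 t20 t4E t6E *.
have w1 : 1 <= w ^+ 2 by rewrite wE t4E t6E; nra.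
have aE : a ^+ 2 = x * x * x * (2 - 3 * x) ^+ 2.
  by rewrite /a t4E -/x /x; ring.
have a2 : 0 <= a ^+ 2 by rewrite sqr_ge0.
have a4 : a ^+ 2 <= x * x.
  have : (2 - 3 * x) ^+ 2 <= 4 by nra.
  have x3 : 0 <= x * x * x by rewrite !mulr_ge0 ?ltW.
  move=> /(ler_wpM2l x3); rewrite -aE; nra.
have c20 : 0 <= c2 by rewrite /c2 t4E; nra.
have S0 : 0 < a ^+ 2 + w ^+ 2 by lra.
have q : 1 - 2 * (x * x) <=
  (c1 * a ^+ 2 + c2 * a ^+ 2 + w ^+ 2) / (a ^+ 2 + w ^+ 2).
  rewrite ler_pdivlMr//.
  have c12 : 0 <= c1 + c2 + 1 by rewrite /c1 /c2 t4E -/x; nra.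
  have xx : 0 <= x * x by rewrite mulr_ge0 ?ltW.
  have : x * x <= x * x * w ^+ 2 by rewrite ler_peMr.
  have := mulr_ge0 xx a2.
  have := mulr_ge0 a2 c12.
  lra.
have c1x : c1 <= - x by rewrite /c1 t4E -/x; nra.
have h2 : 0 <= c2 * g2 by rewrite mulr_ge0.
have h3 : 0 <= c2 * g3 by rewrite mulr_ge0.
have h5 : c1 * g1 <= c1 + 2 * c2 + 2 * (x * x) by lra.
have h6 : x * (1 - g1) <= 8 * (x * x).
  have : 0 <= (- x - c1) * (1 - g1) by rewrite mulr_ge0; lra.
  move: h5; rewrite /c2 t4E -/x; lra.
have : x * (1 - g1) <= x * (8 * x) by lra.
by rewrite ler_pM2l//; lra.
Qed.

(** The inequality of the obstruction along w1 = w3 = 0, with w2 = t, tested on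
    a vector of squared length N. Once g4 >= 0 is dropped and the inequality
    divided by N, what remains besides the terms in c2 is of size t^4, while c2 is
    close to 4 t^2. *)
Lemma axis2_bound t w g1 g2 g3 g4 : 0 < t -> t <= 1 / 2 ->
  w ^+ 2 = 1 - t ^+ 4 - t ^+ 6 ->
  0 <= g1 -> 0 <= g2 -> 0 <= g3 -> 0 <= g4 ->
  let a := (2 * t ^+ 2 + 3 * t ^+ 4) * t in
  let c1 := 3 * t ^+ 4 in let c2 := 9 * t ^+ 4 + 4 * t ^+ 2 in
  let N := 2 * w ^+ 2 + 4 * a ^+ 2 in
  c1 * w ^+ 2 + c2 * (4 * w ^+ 2) + 4 * a ^+ 2 +
    N * (c1 * g1 + c2 * g2 + c1 * g3 + g4) <=
  N * (c1 + 2 * c2 + c1 + 1 -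
    (c1 * a ^+ 2 + c2 * (4 * a ^+ 2) + w ^+ 2) / (2 * a ^+ 2 + w ^+ 2)) ->
  g2 <= 11 * t ^+ 2.
Proof.
move=> t0 t12 wE g10 g20 g30 g40 a c1 c2 N h.
have t2 : t ^+ 2 <= 1 / 4 by nra.
have t20 : 0 < t ^+ 2 by rewrite exprn_gt0.
have t4E : t ^+ 4 = t ^+ 2 * t ^+ 2 by ring.
have t6E : t ^+ 6 = t ^+ 2 * t ^+ 2 * t ^+ 2 by ring.
set x := t ^+ 2 in t2 t20 t4E t6E *.
have w1 : 1 / 2 <= w ^+ 2.
  rewrite wE t4E t6E; have : x * x <= 1 / 16 by nra.
  nra.
have aE : a ^+ 2 = x * x * x * (2 + 3 * x) ^+ 2.
  by rewrite /a t4E -/x /x; ring.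
have a2 : 0 <= a ^+ 2 by rewrite sqr_ge0.
have a4 : a ^+ 2 <= 19 / 10 * (x * x).
  have : (2 + 3 * x) ^+ 2 <= 76 / 10 by nra.
  have x3 : 0 <= x * x * x by rewrite !mulr_ge0 ?ltW.
  move=> /(ler_wpM2l x3); rewrite -aE.
  have : x * x * x <= 1 / 4 * (x * x) by nra.
  lra.
have c10 : 0 <= c1 by rewrite /c1 t4E; nra.
have c20 : 0 <= c2 by rewrite /c2 t4E; nra.
have c2x : 4 * x <= c2 by rewrite /c2 t4E -/x; nra.
have c22 : c2 <= 2 by rewrite /c2 t4E -/x; nra.
have S0 : 0 < 2 * a ^+ 2 + w ^+ 2 by lra.
have N1 : 1 <= N by rewrite /N; lra.
have q : 2 * w ^+ 2 <=
  N * ((c1 * a ^+ 2 + c2 * (4 * a ^+ 2) + w ^+ 2) / (2 * a ^+ 2 + w ^+ 2)).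
  have -> : N = 2 * (2 * a ^+ 2 + w ^+ 2) by rewrite /N; ring.
  rewrite -mulrA [_ * (_ / _)]mulrC divfK ?gt_eqF//.
  have : 0 <= c1 * a ^+ 2 by rewrite mulr_ge0.
  have : 0 <= c2 * a ^+ 2 by rewrite mulr_ge0.
  lra.
have h1 : 0 <= N * (c1 * g1 + c1 * g3 + g4).
  have p1 := mulr_ge0 c10 g10; have p3 := mulr_ge0 c10 g30.
  by rewrite mulr_ge0; lra.
have h2 : N * (c2 * g2) <= N * (2 * c1) + 8 * (a ^+ 2 * c2) + 4 * a ^+ 2.
  have : 0 <= c1 * w ^+ 2 by rewrite mulr_ge0 ?sqr_ge0.
  have e1 : N * (c1 + 2 * c2 + c1 + 1 -
    (c1 * a ^+ 2 + c2 * (4 * a ^+ 2) + w ^+ 2) / (2 * a ^+ 2 + w ^+ 2)) =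
    N * (2 * c1) + 2 * (N * c2) + N - N *
      ((c1 * a ^+ 2 + c2 * (4 * a ^+ 2) + w ^+ 2) / (2 * a ^+ 2 + w ^+ 2)) by ring.
  have e2 : N * c2 = 2 * (c2 * w ^+ 2) + 4 * (a ^+ 2 * c2) by rewrite /N; ring.
  have e3 : N = 2 * w ^+ 2 + 4 * a ^+ 2 by [].
  have e4 : N * (c1 * g1 + c2 * g2 + c1 * g3 + g4) =
    N * (c2 * g2) + N * (c1 * g1 + c1 * g3 + g4) by ring.
  lra.
have h3 : a ^+ 2 * c2 <= a ^+ 2 * 2 by rewrite ler_wpM2l.
have h4 : N * (c2 * g2) <= N * (2 * c1 + 20 * a ^+ 2).
  have : a ^+ 2 <= N * a ^+ 2 by rewrite ler_peMl.
  lra.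
have h5 : c2 * g2 <= 2 * c1 + 20 * a ^+ 2 by rewrite -(ler_pM2l (lt_le_trans ltr01 N1)).
have h6 : 4 * x * g2 <= 4 * x * (11 * x).
  have := ler_wpM2r g20 c2x.
  move: h5; rewrite /c1 t4E -/x; lra.
by rewrite -(ler_pM2l (_ : 0 < 4 * x)) ?mulr_gt0.
Qed.

End RealObstruction.

Section PointwiseObstruction.
Variable R : realType.
Notation C := R[i].
Notation V := (Cspace R 4).
Implicit Types z : V.

Definition sqnorm4 (u : 'I_4 -> C) : R :=
  nsq (u i0) + nsq (u i1) + nsq (u i2) + nsq (u i3).

Lemma dot4 (u : 'rV[C]_4) : (u *m u ^t*) 0 0 = (sqnorm4 (u 0))%:C.
Proof.
rewrite mxE sum4 /sqnorm4 !rmorphD /= !nsqE.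
by rewrite !mxE.
Qed.

Lemma sqnorm4_conj (x : 'cV[C]_4) : sqnorm4 ((x ^t*) 0) =
  nsq (x i0 0) + nsq (x i1 0) + nsq (x i2 0) + nsq (x i3 0).
Proof.
by rewrite /sqnorm4; congr (_ + _ + _ + _); rewrite !mxE; exact: nsq_conj.
Qed.

Lemma nsq1 : nsq (1 : C) = 1.
Proof. by rewrite -(rmorph1 (real_complex R)) nsq_real expr1n. Qed.

Lemma hessian_sqnorm z : complex_hessian (@sqnorm_fun R 4) z = 1%:M.
Proof.
pose E : cpoly R 4 := PAdd (PAdd (PAdd
    (PMul (PVar i0) (PBar i0)) (PMul (PVar i1) (PBar i1)))
  (PMul (PVar i2) (PBar i2))) (PMul (PVar i3) (PBar i3)).
have EP w : (sqnorm_fun w)%:C = ceval E w.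
  rewrite /= -!nsqE -!rmorphD /=; congr (_%:C).
  by rewrite /sqnorm_fun sum4 nsq.unlock.
apply/matrixP => j k; rewrite (hessian_entry EP) mxE /= /unit_at.
move: j; apply: ord4P; move: k; apply: ord4P => /=; ring.
Qed.

(** The value of Upsilon on a covector. *)
Definition dual_form (U : 'M[C]_4) (x : 'cV[C]_4) : R :=
  complex.Re ((x ^t* *m U *m x) 0 0).

Definition dual_bounds (U : 'M[C]_4) :=
  forall t : 'cV[C]_4, 0 <= (t ^t* *m U *m t) 0 0 <= (t ^t* *m t) 0 0.

Lemma dual_formE U x : dual_bounds U -> (dual_form U x)%:C = (x ^t* *m U *m x) 0 0.
Proof.
by move=> /(_ x) /andP[h _]; rewrite real_complexRe// ger0_real.
Qed.

Lemma dual_form_ge0 U x : dual_bounds U -> 0 <= dual_form U x.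
Proof. by move=> h; rewrite -ler0c (dual_formE _ h); have /andP[] := h x. Qed.

Lemma dual_form_le U x : dual_bounds U -> dual_form U x <= sqnorm4 ((x ^t*) 0).
Proof.
move=> h; rewrite -lecR (dual_formE _ h) -dot4 trmxCK.
by have /andP[] := h x.
Qed.

Lemma obstruction_diag c1 c2 c3 c4 (v : 'rV[C]_4) (U : 'M[C]_4) :
  dual_bounds U ->
  let L := skew_diag c1 c2 c3 c4 in
  let Q (u : 'I_4 -> C) := c1 * nsq (skew1 u) + c2 * nsq (skew2 u) +
    c3 * nsq (skew3 u) + c4 * nsq (skew4 u) in
  (forall u : 'rV[C]_4, u *m v ^t* = 0 ->
    (u *m L *m u ^t*) 0 0 + (u *m u ^t*) 0 0 * \tr (U *m L) <=
    (u *m u ^t*) 0 0 *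
      (\tr L - (v *m L *m v ^t*) 0 0 / (v *m v ^t*) 0 0)) ->
  forall u : 'rV[C]_4, u *m v ^t* = 0 ->
  Q (u 0) + sqnorm4 (u 0) * (c1 * dual_form U (xi1 R) + c2 * dual_form U (xi2 R) +
    c3 * dual_form U (xi3 R) + c4 * dual_form U (xi4 R)) <=
  sqnorm4 (u 0) * (c1 + 2 * c2 + c3 + c4 - Q (v 0) / sqnorm4 (v 0)).
Proof.
move=> hU L Q h u ud; have := h u ud.
rewrite !dot4 !skew_diag_form -!/(Q _) trace_skew_diag.
rewrite -!(dual_formE _ hU).
have -> : \tr L = (c1 + 2 * c2 + c3 + c4)%:C.
  have n (x : 'cV[C]_4) : (x ^t* *m x) 0 0 =
      (nsq (x i0 0) + nsq (x i1 0) + nsq (x i2 0) + nsq (x i3 0))%:C.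
    by rewrite -sqnorm4_conj -dot4 trmxCK.
  have n1 : ((xi1 R) ^t* *m xi1 R) 0 0 = 1.
    by rewrite n !mxE /= nsq1 !nsq0 !addr0.
  have n2 : ((xi2 R) ^t* *m xi2 R) 0 0 = 2.
    by rewrite n !mxE /= !addr0 !add0r nsq1 !nsq0 !addr0 rmorphD.
  have n3 : ((xi3 R) ^t* *m xi3 R) 0 0 = 1.
    by rewrite n !mxE /= nsq1 !nsq0 !addr0 !add0r.
  have n4 : ((xi4 R) ^t* *m xi4 R) 0 0 = 1.
    by rewrite n !mxE /= nsq1 !nsq0 !add0r.
  rewrite -[L]mul1mx trace_skew_diag !mulmx1 n1 n2 n3 n4 !mulr1.
  by rewrite !rmorphD rmorphM rmorph_nat [2 * _]mulrC.
rewrite -!(fmorph_div, rmorphM, rmorphD, rmorphB) /=.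
by rewrite lecR.
Qed.

End PointwiseObstruction.

Section ComplexContinuity.
Context {R : realType} {T : topologicalType}.
Variable p : T.
Implicit Types f g : T -> R[i].

Definition ccont f := {for p, continuous (fun z => complex.Re (f z))} /\
  {for p, continuous (fun z => complex.Im (f z))}.

Lemma ccont_cst c : ccont (fun=> c).
Proof. by split; exact: cst_continuous. Qed.

Lemma ccontD f g : ccont f -> ccont g -> ccont (fun z => f z + g z).
Proof.
move=> [f1 f2] [g1 g2]; split.
- rewrite (_ : (fun z => _) = (fun z => complex.Re (f z) + complex.Re (g z))); last first.
    by apply/funext => z; rewrite ReD.
  exact: cvgD.
- rewrite (_ : (fun z => _) = (fun z => complex.Im (f z) + complex.Im (g z))); last first.
    by apply/funext => z; rewrite ImD.
  exact: cvgD.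
Qed.

Lemma ccontM f g : ccont f -> ccont g -> ccont (fun z => f z * g z).
Proof.
move=> [f1 f2] [g1 g2]; split.
- rewrite (_ : (fun z => _) = (fun z => complex.Re (f z) * complex.Re (g z) -
      complex.Im (f z) * complex.Im (g z))); last first.
    by apply/funext => z; rewrite ReM.
  by apply: cvgB; exact: cvgM.
- rewrite (_ : (fun z => _) = (fun z => complex.Re (f z) * complex.Im (g z) +
      complex.Im (f z) * complex.Re (g z))); last first.
    by apply/funext => z; rewrite ImM.
  by apply: cvgD; exact: cvgM.
Qed.

Lemma ccont_conj f : ccont f -> ccont (fun z => Num.conj (f z)).
Proof.
move=> [f1 f2]; split.
- rewrite (_ : (fun z => _) = (fun z => complex.Re (f z)))//.
  by apply/funext => z; case: (f z).
- rewrite (_ : (fun z => _) = (fun z => - complex.Im (f z))); first exact: cvgN.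
  by apply/funext => z; case: (f z).
Qed.

Lemma ccont_sum (I : Type) (r : seq I) (F : I -> T -> R[i]) :
  (forall i, ccont (F i)) -> ccont (fun z => \sum_(i <- r) F i z).
Proof.
move=> h; elim: r => [|i r IH].
  rewrite (_ : (fun z => _) = (fun=> 0)); first exact: ccont_cst.
  by apply/funext => z; rewrite big_nil.
rewrite (_ : (fun z => _) = (fun z => F i z + \sum_(i <- r) F i z)).
  exact: ccontD.
by apply/funext => z; rewrite big_cons.
Qed.

Definition mxcont m n (A : T -> 'M[R[i]]_(m, n)) :=
  forall i j, ccont (fun z => A z i j).

Lemma mxcontM m n q (A : T -> 'M[R[i]]_(m, n)) (B : T -> 'M[R[i]]_(n, q)) :
  mxcont A -> mxcont B -> mxcont (fun z => A z *m B z).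
Proof.
move=> hA hB i j.
rewrite (_ : (fun z => _) = (fun z => \sum_k A z i k * B z k j)).
  by apply: ccont_sum => k; exact: ccontM.
by apply/funext => z; rewrite mxE.
Qed.

Lemma mxcont_adj m n (A : T -> 'M[R[i]]_(m, n)) :
  mxcont A -> mxcont (fun z => (A z) ^t*).
Proof.
move=> hA i j; rewrite (_ : (fun z => _) = (fun z => Num.conj (A z j i))).
  exact: ccont_conj.
by apply/funext => z; rewrite !mxE.
Qed.

End ComplexContinuity.

Section Euclidean.
Variable R : realType.
Notation C := R[i].
Notation V := (Cspace R 4).
Implicit Types z : V.

Definition pole : V := (\row_j (j == i3)%:R, 0).
Definition axis1 : V := (\row_j ((j == i0)%:R - (j == i1)%:R), 0).
Definition axis2 : V := (\row_j (j == i1)%:R, 0).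

Lemma zcoord_axis1 (t w : R) : zcoord (t *: axis1 + w *: pole) =
  fun j => (t * ((j == i0)%:R - (j == i1)%:R) + w * (j == i3)%:R)%:C.
Proof. by apply/funext => j; rewrite /zcoord /= !mxE !mulr0 addr0. Qed.

Lemma zcoord_axis2 (t w : R) : zcoord (t *: axis2 + w *: pole) =
  fun j => (t * (j == i1)%:R + w * (j == i3)%:R)%:C.
Proof. by apply/funext => j; rewrite /zcoord /= !mxE !mulr0 addr0. Qed.

Lemma axis1_skew (t w : R) : let z := t *: axis1 + w *: pole in
  [/\ skew1 (zcoord z) = t%:C, skew2 (zcoord z) = 0, skew3 (zcoord z) = 0 &
      skew4 (zcoord z) = w%:C].
Proof.
rewrite /= zcoord_axis1 /skew1 /skew2 /skew3 /skew4 /=.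
split; rewrite -?rmorphD /=; congr (_%:C); ring.
Qed.

Lemma axis2_skew (t w : R) : let z := t *: axis2 + w *: pole in
  [/\ skew1 (zcoord z) = 0, skew2 (zcoord z) = t%:C, skew3 (zcoord z) = 0 &
      skew4 (zcoord z) = w%:C].
Proof.
rewrite /= zcoord_axis2 /skew1 /skew2 /skew3 /skew4 /=.
split; rewrite -?rmorphD /=; congr (_%:C); ring.
Qed.

Lemma col_form_inj (x y : 'cV[C]_4) :
  (forall u : 'rV[C]_4, (u *m x) 0 0 = (u *m y) 0 0) -> x = y.
Proof.
move=> h; apply/matrixP => i j; rewrite (ord1 j).
have := h (row i 1%:M); rewrite -!row_mul !mul1mx.
by rewrite mxE [in RHS]mxE.
Qed.

Definition real_row (a0 a1 a2 a3 : R) : 'rV[C]_4 :=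
  \row_j (nth 0 [:: a0; a1; a2; a3] j)%:C.

Lemma mul_real_row (u : 'rV[C]_4) a0 a1 a2 a3 :
  (u *m (real_row a0 a1 a2 a3) ^t*) 0 0 =
  u 0 i0 * a0%:C + u 0 i1 * a1%:C + u 0 i2 * a2%:C + u 0 i3 * a3%:C.
Proof.
have e j : ((real_row a0 a1 a2 a3) ^t*) j 0 = (nth 0 [:: a0; a1; a2; a3] j)%:C.
  by rewrite !mxE; exact: conjc_real.
by rewrite mxE sum4 !e.
Qed.

Lemma del_axis1 (t w : R) :
  del (@rho R) (t *: axis1 + w *: pole) =
  (real_row ((3 * t ^+ 4 - 2 * t ^+ 2) * t) 0 0 w) ^t*.
Proof.
have [w1 w2 w3 w4] := axis1_skew t w.
apply: col_form_inj => u; rewrite mul_real_row rho_del /rs /r1 /r2 /r3.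
rewrite w1 w2 w3 w4 nsq0 nsq_real.
have e (a : R) : Num.conj a%:C = a%:C by rewrite conjE oppr0.
rewrite !e ?conjC0 /skew1 /skew2 /skew3 /skew4.
rewrite !(rmorph_nat, rmorphD, rmorphN, rmorphM, rmorphXn, rmorph0) /=.
by ring.
Qed.

Lemma del_axis2 (t w : R) :
  del (@rho R) (t *: axis2 + w *: pole) =
  (real_row ((2 * t ^+ 2 + 3 * t ^+ 4) * t) ((2 * t ^+ 2 + 3 * t ^+ 4) * t) 0 w) ^t*.
Proof.
have [w1 w2 w3 w4] := axis2_skew t w.
apply: col_form_inj => u; rewrite mul_real_row rho_del /rs /r1 /r2 /r3.
rewrite w1 w2 w3 w4 nsq0 nsq_real.
have e (a : R) : Num.conj a%:C = a%:C by rewrite conjE oppr0.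
rewrite !e ?conjC0 /skew1 /skew2 /skew3 /skew4.
rewrite !(rmorph_nat, rmorphD, rmorphN, rmorphM, rmorphXn, rmorph0) /=.
by ring.
Qed.

Lemma rho_axis1 (t w : R) : rho (t *: axis1 + w *: pole) =
  w ^+ 2 - 1 - t ^+ 4 + t ^+ 6.
Proof.
have [w1 w2 w3 w4] := axis1_skew t w.
by rewrite /rho /rs /r1 /r2 /r3 /r4 w1 w2 w3 w4 nsq0 !nsq_real; ring.
Qed.

Lemma rho_axis2 (t w : R) : rho (t *: axis2 + w *: pole) =
  w ^+ 2 - 1 + t ^+ 4 + t ^+ 6.
Proof.
have [w1 w2 w3 w4] := axis2_skew t w.
by rewrite /rho /rs /r1 /r2 /r3 /r4 w1 w2 w3 w4 nsq0 !nsq_real; ring.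
Qed.

(** What weak Z(2) for the Euclidean metric says at z about the (1,1)-vector U,
    stated without frames. *)
Definition euclidean_constraints (U : 'M[C]_4) z :=
  dual_bounds U /\
  forall u : 'rV[C]_4, u *m del (@rho R) z = 0 ->
    (u *m complex_hessian (@rho R) z *m u ^t*) 0 0 +
      (u *m u ^t*) 0 0 * \tr (U *m complex_hessian (@rho R) z) <=
    (u *m u ^t*) 0 0 * (\tr (complex_hessian (@rho R) z) -
      ((del (@rho R) z) ^t* *m complex_hessian (@rho R) z *m del (@rho R) z) 0 0 /
      ((del (@rho R) z) ^t* *m del (@rho R) z) 0 0).

Lemma real_row_nsq a0 a1 a2 a3 : let u := real_row a0 a1 a2 a3 in
  [/\ nsq (skew1 (u 0)) = a0 ^+ 2, nsq (skew2 (u 0)) = (a0 + a1) ^+ 2,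
      nsq (skew3 (u 0)) = a2 ^+ 2, nsq (skew4 (u 0)) = a3 ^+ 2 &
      sqnorm4 (u 0) = a0 ^+ 2 + a1 ^+ 2 + a2 ^+ 2 + a3 ^+ 2].
Proof.
rewrite /= /sqnorm4 /skew1 /skew2 /skew3 /skew4 !mxE /=.
by split; rewrite ?nsq_real// -rmorphD nsq_real.
Qed.

Lemma real_row_orth a0 a1 a2 a3 b0 b1 b2 b3 :
  a0 * b0 + a1 * b1 + a2 * b2 + a3 * b3 = 0 ->
  real_row a0 a1 a2 a3 *m (real_row b0 b1 b2 b3) ^t* = 0.
Proof.
move=> e; apply/matrixP => i j; rewrite (ord1 i) (ord1 j) mul_real_row.
by rewrite !mxE /= -!rmorphM -!rmorphD /= e.
Qed.

(** Up to an error of size t^2, Upsilon has its greatest allowed value on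
    dw1. *)
Lemma axis1_dual (t w : R) U : 0 < t -> t <= 1 / 2 ->
  w ^+ 2 = 1 + t ^+ 4 - t ^+ 6 ->
  euclidean_constraints U (t *: axis1 + w *: pole) -> 1 - 8 * t ^+ 2 <= dual_form U (xi1 R).
Proof.
move=> t0 t12 wE [hU]; have [w1 w2 w3 w4] := axis1_skew t w.
rewrite (hessian_rho_axis1 w2 w3) del_axis1 trmxCK.
have -> : r1 (t *: axis1 + w *: pole) = t ^+ 2 by rewrite /r1 w1 nsq_real.
set a := (_ * t); move=> /(obstruction_diag hU) h.
(* the direction w3, in which the Levi form is nonnegative *)
have := h (real_row 0 0 1 0).
have [-> -> -> -> ->] := real_row_nsq 0 0 1 0.
have [-> -> -> -> ->] := real_row_nsq a 0 0 w.
have g1 : dual_form U (xi1 R) <= 1.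
  apply: (le_trans (dual_form_le (xi1 R) hU)).
  by rewrite sqnorm4_conj !mxE /= nsq1 !nsq0 !addr0.
have g2 := dual_form_ge0 (xi2 R) hU; have g3 := dual_form_ge0 (xi3 R) hU.
have g4 := dual_form_ge0 (xi4 R) hU.
have orth : real_row 0 0 1 0 *m (real_row a 0 0 w) ^t* = 0.
  by apply: real_row_orth; ring.
move=> /(_ orth) k; move: g1 g2 g3 g4 k.
move: (dual_form U (xi1 R)) (dual_form U (xi2 R)) (dual_form U (xi3 R))
  (dual_form U (xi4 R)) => G1 G2 G3 G4 g1 g2 g3 g4 k.
apply: (axis1_bound t0 t12 wE g1 g2 g3 g4); rewrite -/a.
rewrite [a ^+ 2 + w ^+ 2](_ : _ = a ^+ 2 + 0 ^+ 2 + 0 ^+ 2 + w ^+ 2); last by ring.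
move: k; set S := (_ + w ^+ 2)^-1 => k.
rewrite -subr_ge0; move: k; rewrite -subr_ge0; congr (0 <= _); ring.
Qed.

(** Up to an error of size t^2, Upsilon vanishes on dw2. *)
Lemma axis2_dual (t w : R) U : 0 < t -> t <= 1 / 2 ->
  w ^+ 2 = 1 - t ^+ 4 - t ^+ 6 ->
  euclidean_constraints U (t *: axis2 + w *: pole) -> dual_form U (xi2 R) <= 11 * t ^+ 2.
Proof.
move=> t0 t12 wE [hU]; have [w1 w2 w3 w4] := axis2_skew t w.
rewrite (hessian_rho_axis2 w1 w3) del_axis2 trmxCK.
have -> : r2 (t *: axis2 + w *: pole) = t ^+ 2 by rewrite /r2 w2 nsq_real.
set a := (_ * t); move=> /(obstruction_diag hU) h.
(* the tangent vector dual to dw2, which nearly attains mu_3 *)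
have := h (real_row w w 0 (- (2 * a))).
have [-> -> -> -> ->] := real_row_nsq w w 0 (- (2 * a)).
have [-> -> -> -> ->] := real_row_nsq a a 0 w.
have g1 := dual_form_ge0 (xi1 R) hU.
have g2 := dual_form_ge0 (xi2 R) hU; have g3 := dual_form_ge0 (xi3 R) hU.
have g4 := dual_form_ge0 (xi4 R) hU.
have orth : real_row w w 0 (- (2 * a)) *m (real_row a a 0 w) ^t* = 0.
  by apply: real_row_orth; ring.
move=> /(_ orth) k; move: g1 g2 g3 g4 k.
move: (dual_form U (xi1 R)) (dual_form U (xi2 R)) (dual_form U (xi3 R))
  (dual_form U (xi4 R)) => G1 G2 G3 G4 g1 g2 g3 g4 k.
apply: (axis2_bound t0 t12 wE g1 g2 g3 g4); rewrite -/a.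
rewrite [2 * a ^+ 2 + w ^+ 2](_ : _ = a ^+ 2 + a ^+ 2 + 0 ^+ 2 + w ^+ 2); last by ring.
move: k; set S := (_ + w ^+ 2)^-1 => k.
rewrite -subr_ge0; move: k; rewrite -subr_ge0; congr (0 <= _); ring.
Qed.

End Euclidean.

(** A combination of the values on y - 2 x and on 2 y - x in which the cross
    terms cancel. *)
Lemma dual_form_identity (C : numClosedFieldType) n (U : 'M[C]_n)
    (x y : 'cV[C]_n) :
  ((y - 2 *: x) ^t* *m U *m (y - 2 *: x)) 0 0 + 3 * (y ^t* *m U *m y) 0 0 =
  ((2 *: y - x) ^t* *m U *m (2 *: y - x)) 0 0 + 3 * (x ^t* *m U *m x) 0 0.
Proof.
have c2 : Num.conj (2 : C) = 2 by rewrite conjC_nat.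
have trB (a b : 'cV[C]_n) : (a - b) ^t* = a ^t* - b ^t*.
  by apply/matrixP => i j; rewrite !mxE rmorphB.
rewrite !trB !trmxCZ c2 !mulmxBl !mulmxBr -!scalemxAl -!scalemxAr.
have mxB (A B : 'M[C]_1) : (A - B) 0 0 = A 0 0 - B 0 0 by rewrite !mxE.
have mxZ (c : C) (A : 'M[C]_1) : (c *: A) 0 0 = c * A 0 0 by rewrite mxE.
by rewrite !mxB !mxZ ?mxB ?mxZ; ring.
Qed.

Section NoWeakZ.
Variable R : realType.
Notation C := R[i].
Notation V := (Cspace R 4).
Implicit Types z : V.

(** This is where the Euclidean metric enters. If dw1 and dw2 were eigenvectors
    of U for 1 and 0, the value of U on dw2 - 2 dw1 would be 4, but the squared
    Euclidean length of dw2 - 2 dw1 is only 2. *)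
Lemma dual_bounds_gap (U : 'M[C]_4) : dual_bounds U ->
  3 * (dual_form U (xi1 R) - dual_form U (xi2 R)) <= 2.
Proof.
move=> hU.
have e := dual_form_identity U (xi1 R) (xi2 R).
have /andP[_ h1] := hU (xi2 R - 2 *: xi1 R).
have /andP[h2 _] := hU (2 *: xi2 R - xi1 R).
have n1 : ((xi2 R - 2 *: xi1 R) ^t* *m (xi2 R - 2 *: xi1 R)) 0 0 = 2.
  rewrite -{2}[xi2 R - _]trmxCK dot4 sqnorm4_conj.
  have -> : (xi2 R - 2 *: xi1 R) i0 0 = - 1 by rewrite !mxE /=; ring.
  have -> : (xi2 R - 2 *: xi1 R) i1 0 = 1 by rewrite !mxE /=; ring.
  have -> : (xi2 R - 2 *: xi1 R) i2 0 = 0 by rewrite !mxE /=; ring.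
  have -> : (xi2 R - 2 *: xi1 R) i3 0 = 0 by rewrite !mxE /=; ring.
  by rewrite nsqN nsq1 nsq0 !addr0 rmorphD.
rewrite -lecR rmorphM rmorphB /= !dual_formE// !rmorph_nat.
rewrite -n1; apply: le_trans h1; rewrite -subr_ge0; move: h2.
congr (0 <= _); apply/eqP; rewrite -subr_eq0; apply/eqP.
move: e; set a := (_ *m (xi2 R - _)) 0 0; set b := (_ *m (_ - xi1 R)) 0 0.
move=> /eqP; rewrite -subr_eq0 => /eqP e; rewrite -[RHS]oppr0 -e; ring.
Qed.

(** The value of w4 that puts the point with w1 = t (for e = 1) or w2 = t (for
    e = - 1), other coordinates zero, on the boundary. *)
Definition axis_height (t : R) (e : R) := Num.sqrt (1 + e * t ^+ 4 - t ^+ 6).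

Lemma axis_heightE t e : `|e| <= 1 -> 0 <= t -> t <= 1 / 2 ->
  axis_height t e ^+ 2 = 1 + e * t ^+ 4 - t ^+ 6.
Proof.
move=> e1 t0 t1; rewrite sqr_sqrtr//.
have h : t ^+ 2 <= 1 / 4 by nra.
have t4 : t ^+ 4 <= 1 / 16.
  have -> : t ^+ 4 = t ^+ 2 * t ^+ 2 by ring.
  by have := sqr_ge0 t; nra.
have t40 : 0 <= t ^+ 4 by rewrite exprn_ge0.
have t6 : t ^+ 6 <= 1 / 16.
  have -> : t ^+ 6 = t ^+ 4 * t ^+ 2 by ring.
  by have := sqr_ge0 t; nra.
have : - (1 * t ^+ 4) <= e * t ^+ 4.
  by rewrite -mulNr ler_wpM2r//; move: e1; rewrite ler_norml => /andP[].
lra.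
Qed.

Lemma continuous_curve (d : V) e :
  (fun t : R => t *: d + axis_height t e *: pole R) @ (0 : R)^'+ --> pole R.
Proof.
apply: cvg_at_right_filter.
have -> : nbhs (pole R) = nbhs ((0 : R) *: d + axis_height 0 e *: pole R).
  by rewrite scale0r add0r /axis_height !expr0n /= mulr0 addr0 subr0 sqrtr1 scale1r.
apply: cvgD; first by apply: cvgZr_tmp; exact: cvg_id.
apply: cvgZr_tmp; apply: (@continuous_comp _ _ _
  (fun t : R => 1 + e * t ^+ 4 - t ^+ 6) (@Num.sqrt R));
  last exact: sqrt_continuous.
apply: cvgB; last exact: exprn_continuous.
apply: cvgD; first exact: cvg_cst.
apply: cvgM; first exact: cvg_cst.
exact: exprn_continuous.
Qed.

Lemma smooth_mx_cont m n (W : set V) (A : V -> 'M[C]_(m, n)) z :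
  W z -> smooth_mx W A -> mxcont z A.
Proof.
move=> Wz sA i j; have [s1 s2] := sA i j.
by split; [have [+ _] := s1 0%N|have [+ _] := s2 0%N]; apply; rewrite inE.
Qed.

Lemma weakZ_constraints U z F b : boundary (@Omega R) z ->
  is_frame (@rho R) z F -> U = vector11 F b ->
  (let levi := frame_mx (@rho R) z F in
   let omega := frame_mx (@sqnorm_fun R 4) z F in
   let mu := relative_eigenvalues levi omega in
   [/\ forall theta : 'rV[C]_3,
         0 <= pairing (i_theta_thetabar theta) b <= sqnorm_form omega theta,
       0 <= (\sum_(j < 2) mu`_j)%:C - pairing levi b &
       pairing omega b != 2%:R]) ->
  euclidean_constraints U z.
Proof.
move=> /boundaryP z0 [Ff Fa] Ub.
rewrite /frame_mx hessian_sqnorm => -[h1 h2 _].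
have a0 := del_rho_neq0 z0.
have hL := hessian_hermsym (@rhoEP R) z.
split; first exact: (euclidean_bounds Ff Fa a0 Ub h1).
exact: (euclidean_obstruction Ff Fa a0 hL Ub h2).
Qed.

(** By continuity of Upsilon, the estimates along the two curves through the
    pole hold at the pole without their error terms, against [dual_bounds_gap]. *)
Lemma not_weakZ_euclidean : ~ weakZ 2 (@rho R) (@Omega R) (@sqnorm_fun R 4).
Proof.
move=> [U sU hU].
have rhoP : rho (pole R) = 0.
  have := rho_axis1 (0 : R) 1; rewrite scale0r add0r scale1r => ->.
  by ring.
have bP : boundary (@Omega R) (pole R) by apply/boundaryP.
have [W [F [b [oW WP sF sb hF]]]] := sU _ bP.
pose G z := (F z) ^t* *m b z *m F z.
have obs z : W z -> rho z = 0 -> euclidean_constraints (G z) z.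
  move=> Wz z0; have bz : boundary (@Omega R) z by apply/boundaryP.
  have [fz _ Uz] := hF z Wz bz.
  have := weakZ_constraints bz fz Uz (hU z (F z) (b z) bz fz Uz).
  by rewrite Uz.
have cG x : {for pole R, continuous (fun z => dual_form (G z) x)}.
  have cF := smooth_mx_cont WP sF; have cb := smooth_mx_cont WP sb.
  have cx : mxcont (pole R) (fun=> x) by move=> i j; exact: ccont_cst.
  have [] // : ccont (pole R) (fun z => (x ^t* *m G z *m x) 0 0).
  apply: (mxcontM (mxcontM (mxcont_adj cx) (mxcontM (mxcontM (mxcont_adj cF) cb) cF)) cx).
have near_W (d : V) e : \forall t \near (0 : R)^'+, W (t *: d + axis_height t e *: pole R).
  by apply: (continuous_curve d e); exact: open_nbhs_nbhs.
have sq (c : R) : (fun t : R => c * t ^+ 2) @ (0 : R)^'+ --> 0.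
  apply: cvg_at_right_filter.
  have h : (fun t : R => c * t ^+ 2) @ (0 : R) --> c * 0 ^+ 2.
    by apply: cvgM; [exact: cvg_cst|exact: exprn_continuous].
  by move: h; rewrite expr0n /= mulr0.
have g1 : 1 <= dual_form (G (pole R)) (xi1 R).
  have c : (fun t =>
      dual_form (G (t *: axis1 R + axis_height t 1 *: pole R)) (xi1 R) + 8 * t ^+ 2)
      @ (0 : R)^'+ --> dual_form (G (pole R)) (xi1 R).
    rewrite -[X in _ --> X]addr0; apply: cvgD (sq _).
    exact: (cvg_comp _ _ (continuous_curve (axis1 R) 1) (cG _)).
  apply: (cvgr_to_ge c); near=> t.
  have t0 : 0 < t by near: t; exact: nbhs_right_gt.
  have t1 : t <= 1 / 2 by near: t; apply: nbhs_right_le; lra.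
  have Wt : W (t *: axis1 R + axis_height t 1 *: pole R) by near: t; exact: near_W.
  have wE : axis_height t 1 ^+ 2 = 1 + t ^+ 4 - t ^+ 6.
    by rewrite axis_heightE ?normr1 ?mul1r// ltW.
  have := axis1_dual t0 t1 wE (obs _ Wt _).
  by rewrite rho_axis1 wE => /(_ _); rewrite lerBlDr; apply; ring.
have g2 : dual_form (G (pole R)) (xi2 R) <= 0.
  have c : (fun t =>
      dual_form (G (t *: axis2 R + axis_height t (-1) *: pole R)) (xi2 R) - 11 * t ^+ 2)
      @ (0 : R)^'+ --> dual_form (G (pole R)) (xi2 R).
    rewrite -[X in _ --> X]subr0; apply: cvgB (sq _).
    exact: (cvg_comp _ _ (continuous_curve (axis2 R) (-1)) (cG _)).
  apply: (cvgr_to_le c); near=> t.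
  have t0 : 0 < t by near: t; exact: nbhs_right_gt.
  have t1 : t <= 1 / 2 by near: t; apply: nbhs_right_le; lra.
  have Wt : W (t *: axis2 R + axis_height t (-1) *: pole R) by near: t; exact: near_W.
  have wE : axis_height t (-1) ^+ 2 = 1 - t ^+ 4 - t ^+ 6.
    by rewrite axis_heightE ?normrN1 ?mulN1r// ltW.
  have := axis2_dual t0 t1 wE (obs _ Wt _).
  by rewrite rho_axis2 wE => /(_ _); rewrite subr_le0; apply; ring.
have [hP _] := obs _ WP rhoP.
have := dual_bounds_gap hP; lra.
Unshelve. all: by end_near. Qed.

End NoWeakZ.

Theorem proposition6p3 (R : realType) :
  exists (Omega : set (Cspace R 4)) (rho : Cspace R 4 -> R),
    [/\ bounded_domain Omega,
        smooth_defining_function rho Omega,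
        ~ weakZ 2 rho Omega sqnorm_fun &
        exists phi : Cspace R 4 -> R,
          [/\ strictly_plurisubharmonic phi, exhaustion phi &
              weakZ 2 rho Omega phi]].
Proof.
exists (@Omega R), (@rho R); split.
- exact: bounded_domain_Omega.
- exact: defining_rho.
- exact: not_weakZ_euclidean.
- exists (@phi R); split.
  + exact: spsh_phi.
  + exact: exhaustion_phi.
  + exact: weakZ_phi.
Qed.
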